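(* There are at most $147$ diagonal odd-regular ternary quadratic forms (counted up to equivalence). That is, there are at most $147$ triples of positive integers $(a,b,c)$ with $a\le b\le c$ and $\gcd(a,b,c)=1$ such that the quadratic form $ax^2+by^2+cz^2$ is odd-regular.
   Context: All quadratic forms are positive definite, integral (all coefficients $f_{ij}$ of $\sum_{i\le j} f_{ij}x_ix_j$ are integers) and primitive (the coefficients are coprime). A diagonal ternary quadratic form is $\langle a,b,c\rangle = ax^2+by^2+cz^2$. A quadratic form $f$ is called odd-regular if (i) $f$ represents over $\mathbb{Z}$ every odd positive integer that is represented by the genus of $f$ (equivalently, every odd positive integer that is represented by $f$ over $\mathbb{Z}_p$ for every prime $p$), and (ii) the genus of $f$ represents at least one odd positive integer (this is automatic for primitive forms). *)

(* Defs.v *)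
From HB Require Import structures.
From mathcomp Require Import all_boot all_order all_algebra.
From mathcomp Require Import boolp classical_sets functions cardinality.
Set Implicit Arguments.
Unset Strict Implicit.
Unset Printing Implicit Defensive.

Import GRing.Theory.
Local Open Scope ring_scope.

(* The p-adic integers as the inverse limit of the rings Z/p^k: the k-th
   component is the canonical residue modulo p^k (an int in [0, p^k[ when
   p > 0, as forced by padic_coh).  The structure is a commutative ring for
   every p, and is Z_p when p is prime. *)
Record padic_int (p : nat) := PadicInt {
  padic_res :> nat -> int;
  padic_coh : forall k, padic_res k = (padic_res k.+1 %% (p ^ k)%N%:Z)%Z
}.

HB.instance Definition _ p := gen_eqMixin (padic_int p).
HB.instance Definition _ p := gen_choiceMixin (padic_int p).

Section PadicRing.
Variable p : nat.
Implicit Types x y z : padic_int p.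

Lemma padic_eqP x y : (forall k, x k = y k) -> x = y.
Proof.
case: x y => [x cx] [y cy] /= eq_xy.
have {}eq_xy : x = y by apply: funext.
by case: _ / eq_xy in cy *; congr PadicInt; apply: Prop_irrelevance.
Qed.

Lemma modz_pow (m : int) k :
  ((m %% (p ^ k.+1)%N%:Z)%Z = m %[mod (p ^ k)%N%:Z])%Z.
Proof.
rewrite [in RHS](divz_eq m (p ^ k.+1)%N%:Z) expnS PoszM.
by rewrite mulrA modzMDl.
Qed.

Lemma padic_mod x k : (x k %% (p ^ k)%N%:Z)%Z = x k.
Proof. by rewrite {1}padic_coh modz_mod -padic_coh. Qed.

Lemma padic_modS x k : (x k.+1 = x k %[mod (p ^ k)%N%:Z])%Z.
Proof. by rewrite padic_mod -padic_coh. Qed.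

(* The element whose k-th component is the class of s k, for a sequence of
   integers s that is coherent modulo the powers of p. *)
Definition padic_of (s : nat -> int)
    (cs : forall k, (s k.+1 = s k %[mod (p ^ k)%N%:Z])%Z) : padic_int p.
Proof.
exists (fun k => (s k %% (p ^ k)%N%:Z)%Z) => k.
by rewrite modz_pow cs.
Defined.

Fact padic_int_coh (m : int) k : (m = m %[mod (p ^ k)%N%:Z])%Z.
Proof. by []. Qed.

Fact padic_add_coh x y k :
  (x k.+1 + y k.+1 = x k + y k %[mod (p ^ k)%N%:Z])%Z.
Proof. by rewrite -modzDm !padic_modS modzDm. Qed.

Fact padic_opp_coh x k : (- x k.+1 = - x k %[mod (p ^ k)%N%:Z])%Z.
Proof. by rewrite -modzNm padic_modS modzNm. Qed.

Fact padic_mul_coh x y k :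
  (x k.+1 * y k.+1 = x k * y k %[mod (p ^ k)%N%:Z])%Z.
Proof. by rewrite -modzMm !padic_modS modzMm. Qed.

Definition padic_of_int (m : int) := padic_of (padic_int_coh m).
Definition padic_add x y := padic_of (padic_add_coh x y).
Definition padic_opp x := padic_of (padic_opp_coh x).
Definition padic_mul x y := padic_of (padic_mul_coh x y).

Fact padic_addA : associative padic_add.
Proof. by move=> x y z; apply: padic_eqP => k /=; rewrite modzDml modzDmr addrA. Qed.

Fact padic_addC : commutative padic_add.
Proof. by move=> x y; apply: padic_eqP => k /=; rewrite addrC. Qed.

Fact padic_add0 : left_id (padic_of_int 0) padic_add.
Proof. by move=> x; apply: padic_eqP => k /=; rewrite modzDml add0r padic_mod. Qed.

Fact padic_addN : left_inverse (padic_of_int 0) padic_opp padic_add.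
Proof. by move=> x; apply: padic_eqP => k /=; rewrite modzDml addNr. Qed.

HB.instance Definition _ := GRing.isZmodule.Build (padic_int p)
  padic_addA padic_addC padic_add0 padic_addN.

Fact padic_mulA : associative padic_mul.
Proof. by move=> x y z; apply: padic_eqP => k /=; rewrite modzMml modzMmr mulrA. Qed.

Fact padic_mulC : commutative padic_mul.
Proof. by move=> x y; apply: padic_eqP => k /=; rewrite mulrC. Qed.

Fact padic_mul1 : left_id (padic_of_int 1) padic_mul.
Proof. by move=> x; apply: padic_eqP => k /=; rewrite modzMml mul1r padic_mod. Qed.

Fact padic_mulD : left_distributive padic_mul padic_add.
Proof.
move=> x y z; apply: padic_eqP => k /=.
by rewrite modzMml modzDml modzDmr mulrDl.
Qed.

HB.instance Definition _ := GRing.Zmodule_isComPzRing.Build (padic_int p)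
  padic_mulA padic_mulC padic_mul1 padic_mulD.

Lemma padic_intr (m : int) k :
  (m%:~R : padic_int p) k = (m %% (p ^ k)%N%:Z)%Z.
Proof.
suff -> : m%:~R = padic_of_int m by [].
have natE (n : nat) : n%:R = padic_of_int n.
  elim: n => [|n IHn]; first exact: padic_eqP.
  rewrite -addn1 natrD IHn; apply: padic_eqP => j /=.
  by rewrite modzDml modzDmr PoszD.
case: m => n; first by rewrite -natE.
rewrite NegzE mulrNz -[_%:~R]/(n.+1%:R) natE.
by apply: padic_eqP => j /=; rewrite modzNm.
Qed.

End PadicRing.

(* An integral quadratic form in n variables is given by the matrix of its
   coefficients f_ij for i <= j, i.e., it is \sum_(i <= j) f_ij x_i x_j;
   entries strictly below the diagonal are ignored. *)
Definition qform_eval (R : comPzRingType) n (f : 'M[int]_n) (x : 'rV[R]_n) : R :=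
  \sum_(i < n) \sum_(j < n | (i <= j)%N) (f i j)%:~R * (x 0 i * x 0 j).

Definition represents_over (R : comPzRingType) n (f : 'M[int]_n) (m : int) :=
  exists x : 'rV[R]_n, qform_eval f x = m%:~R.

(* A positive integer is represented by the genus of a positive definite form
   exactly when it is represented over Z_p for all primes p; representability
   over the reals is then automatic. *)
Definition genus_represents n (f : 'M[int]_n) (m : int) :=
  forall p : nat, prime p -> represents_over (padic_int p) f m.

Definition odd_regular n (f : 'M[int]_n) :=
  (forall m : nat, odd m -> genus_represents f m -> represents_over int f m)
  /\ (exists m : nat, odd m /\ genus_represents f m).

Definition diag_form (a b c : nat) : 'M[int]_3 :=
  diag_mx (\row_(i < 3) (nth 0%N [:: a; b; c] i)%:Z).

Lemma qform_eval_diag (R : comPzRingType) (a b c : nat) (x : 'rV[R]_3) :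
  qform_eval (diag_form a b c) x =
    a%:R * x 0 0 ^+ 2 + b%:R * x 0 1 ^+ 2 + c%:R * x 0 2%:R ^+ 2.
Proof.
have diagE (i : 'I_3) : \sum_(j < 3 | (i <= j)%N)
    (diag_form a b c i j)%:~R * (x 0 i * x 0 j) =
    (nth 0%N [:: a; b; c] i)%:R * x 0 i ^+ 2.
  rewrite (bigD1 i) //= big1 => [|j /andP[_ neq_ji]].
    by rewrite addr0 !mxE eqxx mulr1n expr2.
  by rewrite !mxE eq_sym (negPf neq_ji) mulr0n mul0r.
rewrite /qform_eval (eq_bigr _ (fun i _ => diagE i)).
rewrite !big_ord_recl big_ord0 addr0 addrA /=.
by congr (_ * x 0 _ ^+ 2 + _ * x 0 _ ^+ 2 + _ * x 0 _ ^+ 2); apply: val_inj.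
Qed.

(* Main.v *)
Require Import Defs.
From Stdlib Require Import NArith.
From mathcomp Require Import all_boot all_order all_algebra.
From mathcomp Require Import algC cyclotomic zify ring.
From mathcomp Require Import boolp classical_sets functions cardinality.

(** Write [<a,b,c>] for the form [a x^2 + b y^2 + c z^2], and call a number
    represented locally when it is represented over every [Z_p].  The proof shows
    that a primitive odd-regular form belongs, up to the order of its coefficients,
    to an explicit table of 147 triples.  The forms in the table are only
    candidates; every other form fails to represent some odd number that it
    represents locally.

    Going down.  Let an odd prime [p] divide [b] and [c] but not [a].  A multiple of
    [p] can only be represented with [p] dividing [x], so that the forms
    [<p a, b/p, c/p>] and, when [p^2] divides both [b] and [c], [<a, b/p^2, c/p^2>]
    inherit odd-regularity ([oreg_down], [oreg_down_sqr]).  Both have a smaller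
    product of coefficients.  The process ends at the forms in which no odd prime
    divides two coefficients, called terminal here.

    Terminal forms.  At an odd prime, a terminal form has two unit coefficients and
    represents all units; so an odd number [n], coprime to [a b c] and congruent
    modulo 8 to a value of the form, is represented locally ([terminal_rep]).  If the
    form is odd-regular with [a <= b <= c], then [a] is at most any such [n], [b] is
    at most any such [n] that is not some [a x^2], and [c] is at most any such [n]
    that is not some [a x^2 + b y^2].  Let [k] be the number of odd primes dividing
    [a b c].  Among any [2^k] successive terms of an arithmetic progression with
    difference prime to these primes, one avoids them all ([sieve]); this gives
    [a b c < 2^16 16^k], whereas [a b c] is at least the product of [k] distinct odd
    primes.  Hence [k <= 20], and the coefficients are bounded
    ([crude_product]).  The bounds are then sharpened by the following remark: if
    pairwise coprime numbers are all smaller than a coefficient and missed by the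
    part of the form before it, then each of them has a prime factor in [a b c], and
    the product of these distinct primes is at most [a b c] ([greedy_bound]).  This
    leaves few enough triples to enumerate: each is in the table or does not
    represent some explicit odd number that it represents locally
    ([terminal_in_table]).

    Going up.  It remains to see that the table is closed under the inverse
    transformations.  Let [f = <a, ..>] be sent to [g] by a transformation at the
    prime [p].  If [g] represents [m] (or [p m], for the first transformation), then
    [f] represents [m] over [Z_q] for all [q <> p]; and it represents [m] over [Z_p]
    if [m] is a unit in the square class of [a].  For [p <= 168] an odd number
    of this kind that [f] does not represent is found by computation, unless [f] is
    itself in the table.  For larger [p], only the transformation
    [<a,b,c> -> <a, p^2 b, p^2 c>] is possible, and below [p^2] the new form only
    represents numbers [a x^2], which allows an explicit choice
    ([oreg_up_sqr_large]). *)

Set Implicit Arguments.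
Unset Strict Implicit.
Unset Printing Implicit Defensive.
Import Order.TTheory GRing.Theory Num.Theory.

(** * Hensel lifting *)

Section Hensel.
Local Open Scope ring_scope.

Lemma padic_limit p (s : nat -> int) :
  (forall k, ((p ^ k)%N%:Z %| s k.+1 - s k)%Z) ->
  {x : padic_int p | forall k, x k = (s k %% (p ^ k)%N%:Z)%Z}.
Proof.
move=> hs.
have cs k : (s k.+1 = s k %[mod (p ^ k)%N%:Z])%Z by apply/eqP; rewrite eqz_mod_dvd.
by exists (padic_of cs).
Qed.

Lemma padicM_res p (x y : padic_int p) k : (x * y) k = (x k * y k %% (p ^ k)%N%:Z)%Z.
Proof. by []. Qed.

Lemma padic_root p (a t : int) (s : nat -> int) :
  (forall k, ((p ^ k)%N%:Z %| s k.+1 - s k)%Z) ->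
  (forall k, ((p ^ k)%N%:Z %| a * s k ^+ 2 - t)%Z) ->
  exists x : padic_int p, a%:~R * x ^+ 2 = t%:~R.
Proof.
move=> hs ha; have [x hx] := padic_limit hs; exists x; apply: padic_eqP => k.
rewrite expr2 !padicM_res !padic_intr !hx modzMml modzMmr mulrA modzMmr mulrAC.
by rewrite modzMmr mulrAC -mulrA -expr2; apply/eqP; rewrite eqz_mod_dvd.
Qed.

(** Newton's iteration, in which one inverse [w] modulo [p] of the derivative
    [2 a x0] serves at all steps: convergence is linear, but the approximations are
    integers given by a closed recursion. *)
Lemma hensel_odd p (a t x0 : int) : prime p -> odd p ->
  ~~ (p%:Z %| a * x0)%Z -> (p%:Z %| a * x0 ^+ 2 - t)%Z ->
  exists x : padic_int p, a%:~R * x ^+ 2 = t%:~R.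
Proof.
move=> pp op pax hx0.
have cop : coprimez (2 * (a * x0)) p%:Z.
  rewrite coprimezMl; apply/andP; split.
    by rewrite coprimezE /= coprime2n.
  by rewrite coprimez_sym coprimezE prime_coprime // -dvdzE.
have [w hw] : exists w : int, (p%:Z %| 1 - 2 * (a * x0) * w)%Z.
  have [[u v] huv] := coprimezP _ _ cop; exists u; apply/dvdzP; exists v.
  by move: huv => /= huv; lia.
pose s := fix s k := if k is k'.+1 then s k' - (a * s k' ^+ 2 - t) * w else x0.
have inv k : ((p ^ k.+1)%N%:Z %| a * s k ^+ 2 - t)%Z /\ (p%:Z %| s k - x0)%Z.
  elim: k => [|k [/dvdzP[e he] /dvdzP[d hd]]] /=.
    by rewrite expn1 subrr dvdz0.
  have [w' hw'] := dvdzP hw.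
  move: (s k) he hd => S; set E := a * S ^+ 2 - t => he hd.
  have ES : a * (S - E * w) ^+ 2 - t = E * (1 - 2 * (a * S) * w) + a * E ^+ 2 * w ^+ 2.
    by rewrite /E; ring.
  split; last first.
    apply/dvdzP; exists (d - e * (p ^ k)%N%:Z * w).
    by rewrite he expnS PoszM mulrBl -hd; ring.
  rewrite ES.
  have -> : 1 - 2 * (a * S) * w = (w' - 2 * a * d * w) * p%:Z.
    have -> : S = x0 + d * p%:Z by rewrite -hd; ring.
    by rewrite mulrBl -hw'; ring.
  rewrite he; apply/dvdzP.
  exists (e * (w' - 2 * a * d * w) + a * e ^+ 2 * (p ^ k)%N%:Z * w ^+ 2).
  by rewrite !expnS !PoszM; ring.
apply: (@padic_root p a t s) => k.
  have [/dvdzP[e he] _] := inv k; rewrite /= he.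
  by apply/dvdzP; exists (- (e * p%:Z * w)); rewrite expnS PoszM; ring.
have [h _] := inv k; apply: dvdz_trans h.
by rewrite expnS PoszM dvdz_mull.
Qed.

(** The derivative [2 a x0] is twice a unit, whence the starting congruence modulo 8
    and a correction by half of the error: [a x0] is its own inverse modulo 2. *)
Lemma hensel_two (a t x0 : int) :
  ~~ (2 %| a * x0)%Z -> (8 %| a * x0 ^+ 2 - t)%Z ->
  exists x : padic_int 2, a%:~R * x ^+ 2 = t%:~R.
Proof.
move=> pax hx0.
pose s := fix s k := if k is k'.+1 then s k' - ((a * s k' ^+ 2 - t) %/ 2)%Z else x0.
have inv k : ((2 ^ k.+3)%N%:Z %| a * s k ^+ 2 - t)%Z /\ (2%:Z %| s k - x0)%Z.
  elim: k => [|k [/dvdzP[e he] /dvdzP[d hd]]] /=.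
    by rewrite subrr dvdz0.
  move: (s k) he hd => S; set E := a * S ^+ 2 - t => he hd.
  have EH : (E %/ 2)%Z = e * (2 ^ k.+2)%N%:Z.
    by rewrite he expnS PoszM (mulrC 2%:Z) mulrA mulzK.
  rewrite EH.
  have [u hu] : exists u, 1 - a * S = 2 * u.
    have -> : S = x0 + d * 2 by rewrite -hd; ring.
    have : exists u, 1 - a * x0 = 2 * u by exists ((1 - a * x0) %/ 2)%Z; lia.
    by case=> u hu; exists (u - a * d); rewrite mulrBr -hu; ring.
  split; last first.
    apply/dvdzP; exists (d - e * (2 ^ k.+1)%N%:Z).
    by rewrite expnS PoszM mulrBl -hd; ring.
  have -> : a * (S - e * (2 ^ k.+2)%N%:Z) ^+ 2 - t = 
     e * (2 ^ k.+3)%N%:Z * (1 - a * S) + a * e ^+ 2 * ((2 ^ k.+2)%N%:Z) ^+ 2.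
    have -> : t = a * S ^+ 2 - e * (2 ^ k.+3)%N%:Z by rewrite -he /E; ring.
    by rewrite (expnS 2 k.+2) PoszM; ring.
  rewrite hu; apply/dvdzP.
  exists (e * u + a * e ^+ 2 * (2 ^ k)%N%:Z).
  by rewrite !expnS !PoszM; ring.
apply: (@padic_root 2 a t s) => k.
  have [/dvdzP[e he] _] := inv k; rewrite /= he.
  rewrite expnS PoszM (mulrC 2%:Z) mulrA mulzK //.
  by apply/dvdzP; exists (- (e * 4)); rewrite !expnS !PoszM; ring.
have [h _] := inv k; apply: dvdz_trans h.
by rewrite !expnS !PoszM !mulrA dvdz_mull.
Qed.

Lemma padic_unit p n : coprime p n -> exists u : padic_int p, n%:R * u = 1.
Proof.
move=> cop.
have [[u v] huv] : exists uv : int * int, uv.1 * n%:Z + uv.2 * p%:Z = 1.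
  have cz : coprimez n%:Z p%:Z by rewrite coprimezE /= coprime_sym.
  by have [uv huv] := coprimezP _ _ cz; exists uv.
pose s := fix s k := if k is k'.+1 then s k' + s k' * (1 - n%:Z * s k') else u.
have inv k : ((p ^ k.+1)%N%:Z %| 1 - n%:Z * s k)%Z.
  elim: k => [|k /dvdzP[e he]] /=.
    by apply/dvdzP; exists v; move: huv => /= huv; rewrite expn1; lia.
  have -> : 1 - n%:Z * (s k + s k * (1 - n%:Z * s k)) = (1 - n%:Z * s k) ^+ 2 by ring.
  rewrite he; apply/dvdzP; exists (e ^+ 2 * (p ^ k)%N%:Z).
  by rewrite !expnS !PoszM; ring.
have dv k : ((p ^ k)%N%:Z %| 1 - n%:Z * s k)%Z.
  by apply: dvdz_trans (inv k); rewrite expnS PoszM dvdz_mull.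
have [|x hx] := @padic_limit p s.
  by move=> k /=; rewrite addrAC subrr add0r dvdz_mull.
exists x; apply: padic_eqP => k.
have := padic_intr p n%:Z k; rewrite -pmulrn => hn.
have := padic_intr p 1 k; rewrite -[1%:~R]/1 => h1.
rewrite padicM_res hn h1 hx modzMml modzMmr.
by apply/eqP; rewrite eq_sym eqz_mod_dvd.
Qed.

End Hensel.

(** * Local representations by diagonal ternary forms *)

Section LocalRepresentations.
Local Open Scope ring_scope.

Definition loc (p a b c m : nat) : Prop :=
  exists x y z : padic_int p,
    a%:R * x ^+ 2 + b%:R * y ^+ 2 + c%:R * z ^+ 2 = m%:R.

Lemma locC12 p a b c m : loc p a b c m -> loc p b a c m.
Proof. by case=> x [y [z E]]; exists y, x, z; rewrite -E; ring. Qed.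

Lemma locC13 p a b c m : loc p a b c m -> loc p c b a m.
Proof. by case=> x [y [z E]]; exists z, y, x; rewrite -E; ring. Qed.

Lemma loc_residual p a b c m (t : int) (y z : int) :
  t = m%:Z - b%:Z * y ^+ 2 - c%:Z * z ^+ 2 ->
  (exists x : padic_int p, a%:Z%:~R * x ^+ 2 = t%:~R) -> loc p a b c m.
Proof.
move=> -> [x hx]; exists x, y%:~R, z%:~R.
by rewrite !pmulrn hx !(rmorphB, rmorphD, rmorphM, rmorphXn) /=; ring.
Qed.

Lemma loc_nonsingular p a b c m (x y z : int) : prime p -> odd p ->
  ~~ (p%:Z %| a%:Z * x)%Z ->
  (p%:Z %| a%:Z * x ^+ 2 + b%:Z * y ^+ 2 + c%:Z * z ^+ 2 - m%:Z)%Z ->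
  loc p a b c m.
Proof.
move=> pp op pax h; apply: (loc_residual (y := y) (z := z)) => //.
apply: (@hensel_odd _ _ _ x) => //.
by move: h; congr (_ %| _)%Z; ring.
Qed.

(** As [p] does not divide [m], it cannot divide all of [a x], [b y], [c z], so one
    of the variables can be lifted by Hensel's lemma with the others fixed. *)
Lemma loc_odd p a b c m (x y z : int) : prime p -> odd p -> ~~ (p %| m)%N ->
  (p%:Z %| a%:Z * x ^+ 2 + b%:Z * y ^+ 2 + c%:Z * z ^+ 2 - m%:Z)%Z ->
  loc p a b c m.
Proof.
move=> pp op pm h.
have [ha|ha] := boolP (p%:Z %| a%:Z * x)%Z; last exact: loc_nonsingular h.
have [hb|hb] := boolP (p%:Z %| b%:Z * y)%Z; last first.
  apply: locC12; apply: (@loc_nonsingular _ _ _ _ _ y x z) => //.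
  by move: h; congr (_ %| _)%Z; ring.
have [hc|hc] := boolP (p%:Z %| c%:Z * z)%Z; last first.
  apply: locC13; apply: (@loc_nonsingular _ _ _ _ _ z y x) => //.
  by move: h; congr (_ %| _)%Z; ring.
case/negP: pm; rewrite -[(_ %| _)%N]/(p%:Z %| m%:Z)%Z.
have -> : m%:Z = x * (a%:Z * x) + y * (b%:Z * y) + z * (c%:Z * z)
   - (a%:Z * x ^+ 2 + b%:Z * y ^+ 2 + c%:Z * z ^+ 2 - m%:Z) by ring.
by rewrite rpredB // ?rpredD // dvdz_mull.
Qed.

Lemma loc_two_first a b c m (x y z : int) :
  ~~ (2 %| a%:Z * x)%Z ->
  (8 %| a%:Z * x ^+ 2 + b%:Z * y ^+ 2 + c%:Z * z ^+ 2 - m%:Z)%Z ->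
  loc 2 a b c m.
Proof.
move=> pax h; apply: (loc_residual (y := y) (z := z)) => //.
apply: (@hensel_two _ _ x) => //.
by move: h; congr (_ %| _)%Z; ring.
Qed.

Lemma loc_two a b c m (x y z : int) : odd m ->
  (8 %| a%:Z * x ^+ 2 + b%:Z * y ^+ 2 + c%:Z * z ^+ 2 - m%:Z)%Z ->
  loc 2 a b c m.
Proof.
move=> pm h.
have [ha|ha] := boolP (2 %| a%:Z * x)%Z; last exact: loc_two_first h.
have [hb|hb] := boolP (2 %| b%:Z * y)%Z; last first.
  apply: locC12; apply: (@loc_two_first _ _ _ _ y x z) => //.
  by move: h; congr (_ %| _)%Z; ring.
have [hc|hc] := boolP (2 %| c%:Z * z)%Z; last first.
  apply: locC13; apply: (@loc_two_first _ _ _ _ z y x) => //.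
  by move: h; congr (_ %| _)%Z; ring.
suff : (2 %| m%:Z)%Z by move: pm; lia.
have -> : m%:Z = x * (a%:Z * x) + y * (b%:Z * y) + z * (c%:Z * z)
   - (a%:Z * x ^+ 2 + b%:Z * y ^+ 2 + c%:Z * z ^+ 2 - m%:Z) by ring.
apply: rpredB; last by apply: dvdz_trans h.
by apply: rpredD; [apply: rpredD|]; apply: dvdz_mull.
Qed.

End LocalRepresentations.

(** The values of [a x^2] and of [t - b y^2] form two sets of [(p + 1) / 2] residues
    modulo [p], and such sets meet. *)
Lemma binary_residue p a b t : prime p -> odd p -> ~~ (p %| a) -> ~~ (p %| b) ->
  exists x y, a * x ^ 2 + b * y ^ 2 = t %[mod p].
Proof.
move=> pp op pa pb; have p0 := prime_gt0 pp.
pose h := p./2.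
have hp : p = h.*2.+1 by rewrite -[LHS]odd_double_half op.
have inj u v : ~~ (p %| u) -> 
    injective (fun i : 'I_h.+1 => Ordinal (ltn_pmod (v + u * i ^ 2) p0)).
  move=> pu i j /(congr1 val) /= /eqP; wlog ij : i j / i <= j.
    move=> W; case: (leqP i j) => [|/ltnW] ij E; first exact: W.
    by apply/esym/W => //; rewrite eq_sym.
  rewrite eqn_modDl eq_sym eqn_mod_dvd ?leq_mul2l ?leq_exp2r ?ij ?orbT // -mulnBr.
  rewrite Euclid_dvdM // (negPf pu) /= subn_sqr Euclid_dvdM //.
  have lj := ltn_ord j; case/orP=> /dvdn_leq D; apply: val_inj => /=; lia.
pose f := fun i : 'I_h.+1 => Ordinal (ltn_pmod (0 + a * i ^ 2) p0).
(* [b * p.-1] stands for [- b] modulo [p]. *)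
pose g := fun i : 'I_h.+1 => Ordinal (ltn_pmod (t + (b * p.-1) * i ^ 2) p0).
have fi : injective f by apply: inj.
have gi : injective g.
  apply: inj; rewrite Euclid_dvdM // (negPf pb) /=.
  by apply/negP => /dvdn_leq D; have := prime_gt1 pp; lia.
have [|] := boolP [exists x, exists y, f x == g y].
  case/existsP=> x /existsP[y /eqP/(congr1 val) /= E]; exists x, y.
  rewrite -modnDml -[_ * _ ^ 2]add0n E modnDml -addnA.
  have -> : b * p.-1 * y ^ 2 + b * y ^ 2 = (b * y ^ 2) * p.
    by rewrite -[in RHS](prednK p0); lia.
  by rewrite addnC modnMDl.
rewrite negb_exists => /forallP H.
have U : uniq (codom f ++ codom g).
  rewrite cat_uniq (map_inj_uniq fi) (map_inj_uniq gi) enum_uniq andbT andTb.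
  apply/hasPn => u /codomP[y ->]; apply/negP => /codomP[x E].
  by have := H x; rewrite negb_exists => /forallP/(_ y); rewrite E eqxx.
have := max_card (mem (codom f ++ codom g)).
by rewrite (card_uniqP U) size_cat !size_codom !card_ord; lia.
Qed.

Lemma PoszM_sqr a x : Posz (a * x ^ 2) = (Posz a * Posz x ^+ 2)%R.
Proof. by rewrite PoszM -mulnn PoszM expr2. Qed.

Lemma loc_unit p a b c m : prime p -> odd p -> ~~ (p %| a) -> ~~ (p %| b) ->
  ~~ (p %| m) -> loc p a b c m.
Proof.
move=> pp op pa pb pm; have [x [y E]] := binary_residue m pp op pa pb.
apply: (@loc_odd _ _ _ _ _ x y 0) => //.
rewrite expr0n mulr0 addr0 -!PoszM_sqr -PoszD -eqz_mod_dvd !modz_nat.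
by rewrite E.
Qed.

(** The hypothesis makes [a x^2 + b y^2] isotropic modulo [p], hence universal over
    [Z_p]: the exponent of [p] in [c] does not matter. *)
Lemma loc_split p a b c m x : prime p -> odd p -> ~~ (p %| a) -> ~~ (p %| b) ->
  p %| a * x ^ 2 + b -> loc p a b c m.
Proof.
move=> pp op pa pb px.
have [pm|] := boolP (p %| m); last exact: loc_unit.
apply: (@loc_nonsingular _ _ _ _ _ x 1 0) => //.
  rewrite -PoszM -[(_ %| _)%Z]/(p %| a * x).
  apply: contra pb => /(dvdn_mulr x); rewrite -mulnA mulnn => h.
  by rewrite -(dvdn_addr _ h).
have : (Posz p %| (Posz (a * x ^ 2 + b) - Posz m)%R)%Z.
  by apply: rpredB; [exact: px|exact: pm].
by rewrite PoszD PoszM_sqr; congr (_ %| _)%Z; ring.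
Qed.

(** When [p] divides [m], a solution of [a x^2 + b y^2 = - c] provides an isotropic
    vector modulo [p] that can be lifted, since [x] and [y] are not both [0]. *)
Lemma loc_good p a b c m : prime p -> odd p -> ~~ (p %| a) -> ~~ (p %| b) -> ~~ (p %| c) ->
  loc p a b c m.
Proof.
move=> pp op pa pb pc.
have [pm|] := boolP (p %| m); last exact: loc_unit.
have [x [y E]] := binary_residue (c * p.-1) pp op pa pb.
have E0 : p %| a * x ^ 2 + b * y ^ 2 + c.
  rewrite /dvdn -modnDml E modnDml -{2}[c]muln1 -mulnDr addn1 prednK ?prime_gt0 //.
  by rewrite modnMl.
have D : (Posz p %| (Posz a * Posz x ^+ 2 + Posz b * Posz y ^+ 2 + Posz c * 1 ^+ 2 - Posz m)%R)%Z.
  have : (Posz p %| (Posz (a * x ^ 2 + b * y ^ 2 + c) - Posz m)%R)%Z.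
    by apply: rpredB; [exact: E0|exact: pm].
  by rewrite !PoszD !PoszM_sqr; congr (_ %| _)%Z; ring.
have [ha|ha] := boolP (p %| a * x); last exact: loc_nonsingular D.
have [hb|hb] := boolP (p %| b * y); last first.
  apply: locC12; apply: (@loc_nonsingular _ _ _ _ _ y x 1) => //.
  by move: D; congr (_ %| _)%Z; ring.
case/negP: pc; rewrite -(dvdn_addr _ (dvdn_mulr x ha)) -(dvdn_addr _ (dvdn_mulr y hb)).
by rewrite -!mulnA !mulnn addnCA addnA.
Qed.

Lemma loc_ramified p a b c m z : prime p -> odd p -> ~~ (p %| c) ->
  ~~ (p %| m) -> c * z ^ 2 = m %[mod p] -> loc p a b (p * c) (p * m).
Proof.
move=> pp op pc pm E.
have [x hx] : exists x : padic_int p, ((Posz c)%:~R * x ^+ 2 = (Posz m)%:~R)%R.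
  apply: (@hensel_odd _ _ _ z) => //.
    rewrite -PoszM -[(_ %| _)%Z]/(p %| c * z).
    apply: contra pm => /(dvdn_mulr z); rewrite -mulnA mulnn => h.
    by rewrite /dvdn -E.
  by rewrite -PoszM_sqr -eqz_mod_dvd !modz_nat E.
exists 0%R, 0%R, x.
by rewrite !natrM expr0n /= !mulr0 !add0r -mulrA; congr (_ * _)%R; rewrite !pmulrn.
Qed.

(** * Odd-regularity and transformations at an odd prime *)

Definition rep (a b c n : nat) : Prop :=
  exists x y z, a * x ^ 2 + b * y ^ 2 + c * z ^ 2 = n.

(** The first condition in the definition of odd-regularity, for a diagonal form with
    natural numbers as variables. *)
Definition oreg (a b c : nat) : Prop := forall m, odd m ->
  (forall p, prime p -> loc p a b c m) -> rep a b c m.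

Lemma repC12 a b c n : rep a b c n -> rep b a c n.
Proof. by case=> x [y [z E]]; exists y, x, z; rewrite -E; lia. Qed.

Lemma repC13 a b c n : rep a b c n -> rep c b a n.
Proof. by case=> x [y [z E]]; exists z, y, x; rewrite -E; lia. Qed.

Lemma oregC12 a b c : oreg a b c -> oreg b a c.
Proof. by move=> h m om hm; apply/repC12/h => // p pp; apply/locC12/hm. Qed.

Lemma oregC13 a b c : oreg a b c -> oreg c b a.
Proof. by move=> h m om hm; apply/repC13/h => // p pp; apply/locC13/hm. Qed.

Lemma odd_regular_oreg a b c : odd_regular (diag_form a b c) -> oreg a b c.
Proof.
case=> h _ m om hm.
have [|x] := h m om.
  move=> p pp; have [x [y [z E]]] := hm p pp.
  exists (\row_i nth 0 [:: x; y; z] i)%R.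
  by rewrite qform_eval_diag !mxE /= -pmulrn -E.
rewrite qform_eval_diag => E.
exists `|x ord0 ord0|%N, `|x ord0 1%R|%N, `|x ord0 2%R|%N.
move: E; rewrite !natz intz => E.
apply/eqP; rewrite -eqz_nat -E !PoszD !PoszM_sqr.
by rewrite !abszE !real_normK ?num_real.
Qed.

Lemma rep_loc a b c n q : rep a b c n -> loc q a b c n.
Proof.
case=> x [y [z <-]]; exists x%:R%R, y%:R%R, z%:R%R.
by rewrite !natrD !natrM !expr2.
Qed.

(** The substitution [x = p x'] sends the form [<a, p b, p c>] to [p] times
    [<p a, b, c>], and it loses no representation of a multiple of [p]. *)
Lemma oreg_down p a b c : prime p -> ~~ (p %| a) -> 
  oreg a (p * b) (p * c) -> odd p -> oreg (p * a) b c.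
Proof.
move=> pp pa h op m om hm.
have [|q pq|x [y [z E]]] := h (p * m); first by rewrite oddM op.
  have [x [y [z E]]] := hm q pq; exists (p%:R * x)%R, y, z.
  by rewrite !natrM -E natrM; ring.
have : p %| x.
  have : p %| a * x ^ 2.
    have D : p %| p * b * y ^ 2 + p * c * z ^ 2 by rewrite -!mulnA -mulnDr dvdn_mulr.
    by rewrite -(dvdn_addl _ D) addnA E dvdn_mulr.
  by rewrite Euclid_dvdM // (negPf pa) /= Euclid_dvdX // andbT.
case/dvdnP=> x' Ex; exists x', y, z; apply/eqP.
rewrite -(eqn_pmul2l (prime_gt0 pp)) -E Ex; apply/eqP.
by rewrite !mulnDr expnMn; lia.
Qed.

Lemma oreg_down_sqr p a b c : prime p -> ~~ (p %| a) -> 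
  oreg a (p ^ 2 * b) (p ^ 2 * c) -> odd p -> oreg a b c.
Proof.
move=> pp pa h op m om hm.
have [|q pq|x [y [z E]]] := h (p ^ 2 * m); first by rewrite oddM oddX op orbT.
  have [x [y [z E]]] := hm q pq; exists (p%:R * x)%R, y, z.
  by rewrite !natrM -E; ring.
have : p %| x.
  have : p %| a * x ^ 2.
    have D : p %| p ^ 2 * b * y ^ 2 + p ^ 2 * c * z ^ 2.
      by rewrite -!mulnA -mulnDr dvdn_mulr // dvdn_exp.
    by rewrite -(dvdn_addl _ D) addnA E dvdn_mulr // dvdn_exp.
  by rewrite Euclid_dvdM // (negPf pa) /= Euclid_dvdX // andbT.
case/dvdnP=> x' Ex; exists x', y, z; apply/eqP.
have p2 : 0 < p ^ 2 by rewrite expn_gt0 prime_gt0.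
rewrite -(eqn_pmul2l p2) -E Ex; apply/eqP.
by rewrite !mulnDr expnMn; lia.
Qed.

(** Over [Z_q] the prime [p] is a unit, so the substitution used for going down is
    invertible. *)
Lemma loc_up q p a b c m : prime q -> prime p -> q != p ->
  loc q (p * a) b c (p * m) -> loc q a (p * b) (p * c) m.
Proof.
move=> pq pp qp [x [y [z E]]].
have [u hu] : exists u : padic_int q, (p%:R * u = 1)%R.
  by apply: padic_unit; rewrite prime_coprime // dvdn_prime2.
exists x, (y * u)%R, (z * u)%R.
have -> : (m%:R = u * (p * m)%:R :> padic_int q)%R.
  by rewrite natrM mulrA (mulrC u) hu mul1r.
rewrite -E !natrM.
transitivity (a%:R * x ^+ 2 + (p%:R * u) * u * (b%:R * y ^+ 2)
   + (p%:R * u) * u * (c%:R * z ^+ 2))%R; first by ring.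
transitivity ((p%:R * u) * a%:R * x ^+ 2 + u * (b%:R * y ^+ 2)
   + u * (c%:R * z ^+ 2))%R; last by ring.
by rewrite hu !mul1r.
Qed.

Lemma loc_up_sqr q p a b c m : prime q -> prime p -> q != p ->
  loc q a b c m -> loc q a (p ^ 2 * b) (p ^ 2 * c) m.
Proof.
move=> pq pp qp [x [y [z E]]].
have [u hu] : exists u : padic_int q, (p%:R * u = 1)%R.
  by apply: padic_unit; rewrite prime_coprime // dvdn_prime2.
exists x, (y * u)%R, (z * u)%R.
rewrite -E !natrM.
transitivity (a%:R * x ^+ 2 + (p%:R * u) ^+ 2 * (b%:R * y ^+ 2)
   + (p%:R * u) ^+ 2 * (c%:R * z ^+ 2))%R; first by ring.
by rewrite hu expr1n !mul1r.
Qed.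

Lemma loc_square p a b c m x : prime p -> odd p -> ~~ (p %| m) ->
  a * x ^ 2 = m %[mod p] -> loc p a b c m.
Proof.
move=> pp op pm E; apply: (@loc_odd _ _ _ _ _ x 0 0) => //.
by rewrite expr0n !mulr0 !addr0 -PoszM_sqr -eqz_mod_dvd !modz_nat E.
Qed.

(** The tool for rejecting a form above a known one: a number [m] satisfying these
    hypotheses is represented locally, so it suffices to see that it is not
    represented. *)
Lemma witness_up p a b c m x : prime p -> odd p -> odd m -> ~~ (p %| m) ->
  a * x ^ 2 = m %[mod p] -> rep (p * a) b c (p * m) ->
  oreg a (p * b) (p * c) -> rep a (p * b) (p * c) m.
Proof.
move=> pp op om pm E r h; apply: h => // q pq.
have [->|qp] := eqVneq q p; first exact: loc_square E.
by apply: loc_up => //; apply: rep_loc.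
Qed.

Lemma witness_up_sqr p a b c m x : prime p -> odd p -> odd m -> ~~ (p %| m) ->
  a * x ^ 2 = m %[mod p] -> (forall q, prime q -> q != p -> loc q a b c m) ->
  oreg a (p ^ 2 * b) (p ^ 2 * c) -> rep a (p ^ 2 * b) (p ^ 2 * c) m.
Proof.
move=> pp op om pm E r h; apply: h => // q pq.
have [->|qp] := eqVneq q p; first exact: loc_square E.
by apply: loc_up_sqr => //; apply: r.
Qed.

(** * Transformations at a large prime *)

Lemma int_square_sum a b c x y z : 
  (Posz a * Posz x ^+ 2 + Posz b * Posz y ^+ 2 + Posz c * Posz z ^+ 2)%R = 
  Posz (a * x ^ 2 + b * y ^ 2 + c * z ^ 2).
Proof. by rewrite !PoszD !PoszM_sqr. Qed.

(** Whether a unit is represented over [Z_q] only depends on its residue modulo [q]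
    (modulo 8 when [q] is [2]), and at the odd primes that do not divide [a b c] there
    is no condition. *)
Lemma loc_congruent M a b c v m q : 8 %| M ->
  (forall q, prime q -> odd q -> q %| a * b * c -> q %| M) ->
  rep a b c v -> coprime v M -> m = v %[mod M] -> prime q -> loc q a b c m.
Proof.
move=> M8 hM [x [y [z E]]] cop mv pq.
have copm : coprime m M by rewrite -coprime_modl mv coprime_modl.
have D d : d %| M -> (Posz d %| Posz a * Posz x ^+ 2 + Posz b * Posz y ^+ 2 
    + Posz c * Posz z ^+ 2 - Posz m)%Z%R.
  move=> dM; rewrite int_square_sum E -eqz_mod_dvd !modz_nat.
  by rewrite -(modn_dvdm v dM) -mv modn_dvdm.
have oddm : odd m.
  rewrite -coprime2n coprime_sym; apply: coprime_dvdr copm.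
  by apply: dvdn_trans M8.
have [oq|] := boolP (odd q); last first.
  by case: (even_prime pq) => [-> _|->] //; apply: (loc_two oddm (D _ M8)).
have [qM|qM] := boolP (q %| M).
  apply: loc_odd (D _ qM) => //.
  rewrite -prime_coprime // coprime_sym; exact: coprime_dvdr copm.
have h : ~~ (q %| a * b * c) by apply: contra qM; apply: hM.
move: h; rewrite !Euclid_dvdM // !negb_or => /andP[/andP[qa qb] qc].
exact: loc_good.
Qed.

(** Below [p^2] the form only represents numbers [a y^2].  When [a > 1], a number
    congruent to [v] modulo [M] is coprime to [a], and such a number in the square
    class of [a] modulo [p] exists below [p M].  When [a = 1], the candidates are
    [1 + M p] and [121 + M p]: two squares that large do not differ by 120. *)
Lemma oreg_up_sqr_large M p v a b c : 8 %| M -> 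
  (forall q, prime q -> odd q -> q %| a * b * c -> q %| M) ->
  0 < a -> 0 < b -> 0 < c ->
  rep a b c v -> coprime v M -> coprime 11 M ->
  prime p -> M < p -> 121 < p -> ~ oreg a (p ^ 2 * b) (p ^ 2 * c).
Proof.
move=> M8 hM a0 b0 c0 rv cv c11 pp Mp p121 h.
have M0 : 0 < M.
  by rewrite lt0n; apply: contraTneq cv => M0; rewrite M0 in c11.
have op : odd p by case: (even_prime pp) p121 => // ->.
have pM : ~~ (p %| M) by apply/negP => /dvdn_leq; lia.
have pa : ~~ (p %| a).
  by apply: contra pM => pa; apply: hM => //; rewrite -mulnA dvdn_mulr.
have key w m x : rep a b c w -> coprime w M -> m = w %[mod M] ->
   a * x ^ 2 = m %[mod p] -> ~~ (p %| m) -> m < p ^ 2 -> exists y, m = a * y ^ 2.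
  move=> rw cw mw ax pm mlt.
  have copm : coprime m M by rewrite -coprime_modl mw coprime_modl.
  have oddm : odd m.
    rewrite -coprime2n coprime_sym; apply: coprime_dvdr copm.
    by apply: dvdn_trans M8.
  have [|y [u [t E]]] := @witness_up_sqr p a b c m x pp op oddm pm ax _ h.
    by move=> q pq _; apply: (loc_congruent (M := M) (v := w)).
  exists y; rewrite -E.
  have bound d s : 0 < d -> p ^ 2 * d * s ^ 2 <= m -> s = 0.
    move=> d0 /leq_ltn_trans/(_ mlt); rewrite -mulnA -{2}[p ^ 2]muln1.
    rewrite ltn_pmul2l ?expn_gt0 ?prime_gt0 // ltnS leqn0 muln_eq0 expn_eq0 andbT.
    by rewrite eqn0Ngt d0 => /eqP.
  have -> : u = 0 by apply: (bound b u b0); rewrite -E -addnA addnCA leq_addr.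
  have -> : t = 0 by apply: (bound c t c0); rewrite -E leq_addl.
  by rewrite exp0n // !muln0 !addn0.
have [a1|a1] := ltnP 1 a.
  have cpM : coprime p M by rewrite prime_coprime.
  set m := chinese p M a v %% (p * M).
  have mv : m = v %[mod M] by rewrite /m modn_dvdm ?dvdn_mull // chinese_modr.
  have ma : m = a %[mod p] by rewrite /m modn_dvdm ?dvdn_mulr // chinese_modl.
  have [|||y E] := key v m 1 rv cv mv; first by rewrite muln1 ma.
  - by rewrite /dvdn ma.
  - have : m < p * M by rewrite ltn_mod muln_gt0 M0 prime_gt0.
    by rewrite -mulnn => mlt; apply: leq_trans mlt _; rewrite leq_mul2l (ltnW Mp) orbT.
  have copm : coprime m M by rewrite -coprime_modl mv coprime_modl.
  have rM : pdiv a %| M.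
    have pr := pdiv_prime a1.
    have [->|o] := even_prime pr; first by apply: dvdn_trans M8.
    by apply: hM => //; rewrite -mulnA dvdn_mulr ?pdiv_dvd.
  have : pdiv a %| gcdn m M by rewrite dvdn_gcd rM E dvdn_mulr ?pdiv_dvd.
  by rewrite (eqP copm) dvdn1 => /eqP e1; have := pdiv_prime a1; rewrite e1.
have {a1}a1 : a = 1 by lia.
have sq t : coprime t M -> 0 < t -> t <= 11 -> exists y, t ^ 2 + M * p = y ^ 2.
  move=> ct t0 t11; have t2 : t ^ 2 <= 121 by rewrite -[121]/(11 ^ 2) leq_exp2r.
  have [||||||y] := key (t ^ 2) (t ^ 2 + M * p) t; last by rewrite a1 mul1n; exists y.
  - by exists t, 0, 0; rewrite a1 !muln0 !addn0 mul1n.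
  - by rewrite coprimeXl.
  - by rewrite addnC mulnC modnMDl.
  - by rewrite a1 mul1n addnC modnMDl.
  - rewrite (dvdn_addl _ (dvdn_mull M (dvdnn p))) Euclid_dvdX // andbT.
    by apply/negP => /dvdn_leq; lia.
  - have : M.+1 * p <= p ^ 2 by rewrite -mulnn leq_mul2r Mp orbT.
    by rewrite mulSn; move: t2 p121; clear; lia.
(* Both squares are odd, so that their roots differ by at least 2. *)
have [y1 E1] := sq 1 (coprime1n _) isT isT.
have [y2 E2] := sq 11 c11 isT isT.
have M_8 : 8 <= M by apply: dvdn_leq.
have y1_30 : 30 <= y1.
  rewrite leqNgt; apply/negP => y1_lt.
  have : y1 ^ 2 <= 29 ^ 2 by rewrite leq_exp2r.
  by rewrite -E1; have := leq_mul M_8 p121; clear; lia.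
have oM : odd M = false.
  by apply/negbTE; rewrite -dvdn2; apply: dvdn_trans M8.
have par y t : odd t -> t ^ 2 + M * p = y ^ 2 -> odd y.
  by move=> ot /(congr1 odd); rewrite oddD oddM !oddX ot oM /= => <-.
have o1 := par _ 1 isT E1; have o2 := par _ 11 isT E2.
have {E1 E2} E : y2 ^ 2 = y1 ^ 2 + 120 by rewrite -E1 -E2; clear; lia.
have y12 : y1 < y2 by rewrite -(@ltn_exp2r _ _ 2) // E; clear; lia.
have y12' : y1.+2 <= y2.
  by rewrite ltn_neqAle y12 andbT; apply: contraTneq o2 => <-; rewrite /= o1.
have : y1.+2 ^ 2 <= y2 ^ 2 by rewrite leq_exp2r.
by rewrite E -addn2 sqrnD; move: y1_30; clear; lia.
Qed.

(** * Numbers coprime to given primes in an arithmetic progression *)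

Section Sieve.
Local Open Scope ring_scope.

(** A sum of [d] geometric sequences satisfies a linear recurrence of order [d], whose
    characteristic polynomial is the product of the [X - x.2]; so it vanishes as
    soon as its first [d] terms do. *)
Lemma geometric_sum_eq0 (R : idomainType) (l : seq (R * R)) (u : nat -> R) :
  (forall i, u i = \sum_(x <- l) x.1 * x.2 ^+ i) ->
  (forall i, (i < size l)%N -> u i = 0) -> forall i, u i = 0.
Proof.
move=> hu h0; elim/ltn_ind => i IH.
have [/h0//|di] := ltnP i (size l).
pose q := \prod_(x <- l) ('X - x.2%:P).
have sq : size q = (size l).+1 by rewrite size_prod_XsubC.
have mq : q`_(size l) = 1.
  by have /monicP := monic_prod_XsubC l xpredT (fun x => x.2); rewrite /lead_coef sq.
have : \sum_(t < (size l).+1) q`_t * u (i - size l + t)%N = 0.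
  under eq_bigr => t _ do rewrite hu mulr_sumr.
  rewrite exchange_big /= big1_seq // => x /andP[_ xl].
  transitivity (x.1 * x.2 ^+ (i - size l) * q.[x.2]).
    rewrite horner_coef sq mulr_sumr; apply: eq_bigr => t _.
    by rewrite exprD; ring.
  suff -> : q.[x.2] = 0 by rewrite mulr0.
  rewrite /q horner_prod; apply/eqP; rewrite prodf_seq_eq0; apply/hasP.
  by exists x => //=; rewrite hornerXsubC subrr.
rewrite big_ord_recr /= mq mul1r subnK // big1 ?add0r // => t _.
by rewrite IH ?mulr0 //; have := ltn_ord t; lia.
Qed.

(** With [z p] a primitive [p]-th root of unity, the product of the
    [1 - z p ^ (s + M i)] vanishes exactly when some [p] in [P] divides [s + M i].
    Expanded, it is a sum of [2 ^ size P] geometric sequences in [i], so it would be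
    identically zero if it were for all [i < 2 ^ size P]; but some term of the
    progression is congruent to [1] modulo all [p]. *)
Lemma sieve (P : seq nat) (s M : nat) : (0 < M)%N ->
  {in P, forall p, prime p && coprime p M} ->
  exists2 i, (i < 2 ^ size P)%N & {in P, forall p, ~~ (p %| s + M * i)%N}.
Proof.
move=> M0 hP.
pose z p : algC := sval (C_prim_root_exists (ltn0Sn p.-1)).
have hz : {in P, forall p, p.-primitive_root (z p)}.
  move=> p /hP/andP[/prime_gt0 p0 _].
  by rewrite -[X in X.-primitive_root _](prednK p0); apply: (svalP (C_prim_root_exists _)).
pose u i := \prod_(p <- P) (1 - z p ^+ (s + M * i)).
have [l sl ul] : exists2 l : seq (algC * algC), size l = (2 ^ size P)%N &
    forall i, u i = \sum_(x <- l) x.1 * x.2 ^+ i.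
  rewrite /u; elim: P {hP hz u} => [|p P [l sl ul]].
    by exists [:: (1, 1)] => // i; rewrite big_nil big_seq1 expr1n mulr1.
  exists (l ++ [seq (- (z p ^+ s) * x.1, z p ^+ M * x.2) | x <- l]).
    by rewrite size_cat size_map sl expnS mul2n addnn.
  move=> i; rewrite big_cons ul big_cat big_map /= mulrBl mul1r; congr (_ + _).
  rewrite mulr_sumr -sumrN; apply: eq_bigr => x _.
  by rewrite exprMn exprD exprM; ring.
have u0 i : u i = 0 -> exists2 p, p \in P & (p %| s + M * i)%N.
  move/eqP; rewrite prodf_seq_eq0 => /hasP[p pP /=]; rewrite subr_eq0 eq_sym => e.
  by exists p; rewrite // (prim_order_dvd (hz p pP)).
have [/forallP h|] := boolP [forall i : 'I_(2 ^ size P), u i == 0]; last first.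
  rewrite negb_forall => /existsP[i ui]; exists i => // p pP.
  apply: contra ui => pd; rewrite prodf_seq_eq0; apply/hasP; exists p => //=.
  by rewrite subr_eq0 eq_sym -(prim_order_dvd (hz p pP)).
pose N := (\prod_(p <- P) p)%N.
have cN : coprime M N.
  rewrite /N big_seq; apply: (big_ind (coprime M)) => [|x y|p /hP/andP[_]]; rewrite ?coprimen1 //.
    by rewrite coprimeMr => -> ->.
  by rewrite coprime_sym.
pose x := (chinese M N s 1 + M * (N * s))%N.
have N0 : (0 < N)%N.
  rewrite /N big_seq; apply: (big_ind (leq 1)) => [//|y t|p /hP/andP[/prime_gt0 //]].
  by rewrite muln_gt0 => -> ->.
have xs : (s <= x)%N.
  by rewrite /x (leq_trans _ (leq_addl _ _)) // mulnA leq_pmull // muln_gt0 M0.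
have Mx : (M %| x - s)%N.
  by rewrite -eqn_mod_dvd // /x addnC (mulnC M) modnMDl chinese_modl.
have xE : (s + M * ((x - s) %/ M) = x)%N by rewrite mulnC divnK // subnKC.
have [|p pP] := u0 ((x - s) %/ M)%N.
  by apply: (geometric_sum_eq0 ul) => i il; apply/eqP/(h (Ordinal _)); rewrite -sl.
rewrite xE => px; have /andP[pp _] := hP p pP.
have : x = 1 %[mod p].
  have pN : (p %| N)%N by rewrite /N (big_rem p) //= dvdn_mulr.
  rewrite -(modn_dvdm x pN) -[in RHS](modn_dvdm 1 pN); congr (_ %% _)%N.
  by rewrite /x mulnCA addnC (mulnC N) modnMDl chinese_modr.
by rewrite (eqP px) modn_small ?prime_gt1.
Qed.

End Sieve.

(** * Products of distinct odd primes *)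

Lemma coprime_no_prime n m : 0 < n ->
  (forall q, prime q -> q %| n -> q %| m -> False) -> coprime n m.
Proof.
move=> n0 h; rewrite /coprime eqn_leq gcdn_gt0 n0 andbT leqNgt; apply/negP => g.
by apply: (h (pdiv (gcdn n m)));
  rewrite ?pdiv_prime // (dvdn_trans (pdiv_dvd _)) ?dvdn_gcdl ?dvdn_gcdr.
Qed.

Lemma prod_primes_dvd (s : seq nat) n : uniq s -> all prime s ->
  {in s, forall p, p %| n} -> \prod_(p <- s) p %| n.
Proof.
elim: s => [|p s IH] /=; first by rewrite big_nil dvd1n.
case/andP=> ps us /andP[pp as_] h; rewrite big_cons Gauss_dvd.
  by rewrite h ?mem_head // IH // => q qs; apply: h; rewrite inE qs orbT.
rewrite big_seq; apply: (big_ind (coprime p)) => [|x y|q qs]; rewrite ?coprimen1 //.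
  by rewrite coprimeMr => -> ->.
rewrite prime_coprime // dvdn_prime2 // ?(allP as_) //.
by apply: contraNneq ps => ->.
Qed.

Lemma prod_le_expn (s : seq nat) N : {in s, forall q, q <= N} ->
  \prod_(q <- s) q <= N ^ size s.
Proof.
elim: s => [|q s IH] h; first by rewrite big_nil.
rewrite big_cons expnS leq_mul ?h ?mem_head // IH // => x xs.
by apply: h; rewrite inE xs orbT.
Qed.

Lemma expn_le_prod (s : seq nat) N : {in s, forall q, N <= q} ->
  N ^ size s <= \prod_(q <- s) q.
Proof.
elim: s => [|q s IH] h; first by rewrite big_nil.
rewrite big_cons expnS leq_mul ?h ?mem_head // IH // => x xs.
by apply: h; rewrite inE xs orbT.
Qed.

(** Passing from [Q] to [s] replaces factors at most [N] by factors at least [N]; the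
    powers of [N] account for the difference of lengths. *)
Lemma prod_exchange (Q s : seq nat) N : uniq Q -> uniq s ->
  {in Q, forall q, q <= N} -> {in s, forall p, p \notin Q -> N <= p} ->
  \prod_(q <- Q) q * N ^ size s <= \prod_(p <- s) p * N ^ size Q.
Proof.
move=> uQ us hQ hs.
have pI : perm_eq [seq q <- Q | q \in s] [seq p <- s | p \in Q].
  by apply: uniq_perm; rewrite ?filter_uniq // => x; rewrite !mem_filter andbC.
have split (u v : seq nat) : exists2 w, perm_eq ([seq x <- u | x \in v] ++ w) u
    & {subset w <= [predI u & [predC v]]}.
  exists [seq x <- u | x \notin v]; first by rewrite perm_filterC.
  by move=> x; rewrite mem_filter inE /= andbC.
have [Q' eQ sQ] := split Q s; have [s' es ss] := split s Q.
rewrite -(perm_big _ eQ) -(perm_big _ es) -(perm_size eQ) -(perm_size es) /=.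
rewrite !big_cat !size_cat !expnD /= (perm_big _ pI) (perm_size pI) /=.
have h1 : \prod_(q <- Q') q <= N ^ size Q'.
  by apply: prod_le_expn => x /sQ /andP[/hQ].
have h2 : N ^ size s' <= \prod_(p <- s') p.
  by apply: expn_le_prod => x /ss /andP[/= xs]; apply: hs.
rewrite -!mulnA leq_mul2l; apply/orP; right.
by rewrite mulnCA [X in _ <= X]mulnCA leq_mul2l mulnC leq_mul ?orbT.
Qed.

(** Each prime beyond the size of [Q] contributes a factor [N] to the product, and
    only [X <= N] to the bound. *)
Lemma size_le_of_prod_lt (Q s : seq nat) N C X : uniq Q -> uniq s ->
  {in Q, forall q, q <= N} -> {in s, forall p, p \notin Q -> N <= p} ->
  X <= N -> 0 < N -> C * X ^ (size Q).+1 <= \prod_(q <- Q) q * N ->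
  \prod_(p <- s) p < C * X ^ size s -> size s <= size Q.
Proof.
move=> uQ us hQ hs XN N0 hC lt; rewrite leqNgt; apply/negP => sz.
have [j Ej] : exists j, size s = (size Q).+1 + j.
  by exists (size s - (size Q).+1); rewrite subnKC.
have := prod_exchange uQ us hQ hs; apply/negP; rewrite -ltnNge.
apply: leq_trans (_ : C * X ^ size s * N ^ size Q <= _).
  by rewrite ltn_pmul2r ?expn_gt0 ?N0.
have XNj : X ^ j <= N ^ j by case: (j) => // j'; rewrite leq_exp2r.
have -> : C * X ^ size s * N ^ size Q = C * X ^ (size Q).+1 * X ^ j * N ^ size Q.
  by rewrite Ej expnD mulnA.
have -> : \prod_(q <- Q) q * N ^ size s = \prod_(q <- Q) q * N * N ^ j * N ^ size Q.
  by rewrite Ej expnD expnS; ring.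
by rewrite leq_mul2r leq_mul ?orbT.
Qed.

Definition odd_primes n := [seq p <- primes n | odd p].

Lemma mem_odd_primes n p : 0 < n ->
  (p \in odd_primes n) = [&& prime p, odd p & p %| n].
Proof. by move=> n0; rewrite mem_filter mem_primes n0 /= andbCA. Qed.

Lemma prod_odd_primes_le n : 0 < n -> \prod_(p <- odd_primes n) p <= n.
Proof.
move=> n0; apply: dvdn_leq => //; apply: prod_primes_dvd.
- by rewrite filter_uniq ?primes_uniq.
- by apply/allP => p; rewrite mem_odd_primes // => /and3P[].
by move=> p; rewrite mem_odd_primes // => /and3P[].
Qed.

(** The product of the odd primes up to 79 exceeds [2 ^ 16 * 16 ^ 21]. *)
Lemma size_odd_primes_20 n : 0 < n -> n < 2 ^ 16 * 16 ^ size (odd_primes n) ->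
  size (odd_primes n) <= 20.
Proof.
move=> n0 lt.
pose Q := [:: 3; 5; 7; 11; 13; 17; 19; 23; 29; 31; 37; 41; 43; 47; 53; 59; 61; 67; 71; 73].
apply: (@size_le_of_prod_lt Q _ 79 (2 ^ 16) 16) => //.
- by rewrite filter_uniq ?primes_uniq.
- by apply/allP.
- move=> p; rewrite mem_odd_primes // => /and3P[pp op _]; apply: contraR.
  rewrite -ltnNge => p79.
  have /allP/(_ p) : all (fun p => prime p && odd p ==> (p \in Q)) (iota 0 79) by vm_compute.
  by rewrite mem_iota pp op /= p79 => ->.
- by rewrite /Q !big_cons big_nil [size _]/=; lia.
exact: leq_ltn_trans (prod_odd_primes_le n0) lt.
Qed.

Lemma size_odd_primes_10 n C X : 0 < n -> X <= 37 -> 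
  C * X ^ 11 <= 3 * 5 * 7 * 11 * 13 * 17 * 19 * 23 * 29 * 31 * 37 ->
  n < C * X ^ size (odd_primes n) -> size (odd_primes n) <= 10.
Proof.
move=> n0 X37 CX lt.
pose Q := [:: 3; 5; 7; 11; 13; 17; 19; 23; 29; 31].
apply: (@size_le_of_prod_lt Q _ 37 C X) => //.
- by rewrite filter_uniq ?primes_uniq.
- by apply/allP.
- move=> p; rewrite mem_odd_primes // => /and3P[pp op _]; apply: contraR.
  rewrite -ltnNge => p79.
  have /allP/(_ p) : all (fun p => prime p && odd p ==> (p \in Q)) (iota 0 37) by vm_compute.
  by rewrite mem_iota pp op /= p79 => ->.
- by apply: leq_trans CX _; rewrite /Q !big_cons big_nil; lia.
exact: leq_ltn_trans (prod_odd_primes_le n0) lt.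
Qed.

(** * Forms with pairwise coprime odd parts *)

Definition odd_coprime a b := forall q, prime q -> odd q -> q %| a -> q %| b -> False.

Lemma odd_coprimeC a b : odd_coprime a b -> odd_coprime b a.
Proof. by move=> h q pq oq qa qb; apply: h qb qa. Qed.

(** The forms to which no transformation at an odd prime applies. *)
Definition terminal a b c :=
  [/\ odd_coprime a b, odd_coprime a c & odd_coprime b c].

Lemma terminal_loc_unit a b c q n : terminal a b c -> prime q -> odd q ->
  ~~ (q %| n) -> loc q a b c n.
Proof.
move=> [ab ac bc] pq oq qn.
have [qa|qa] := boolP (q %| a).
  apply/locC13/loc_unit => //; first by apply/negP => /(ac q pq oq qa).
  by apply/negP => /(ab q pq oq qa).
have [qb|qb] := boolP (q %| b); last exact: loc_unit.
apply/locC12/locC13/loc_unit => //; first by apply/negP => /(bc q pq oq qb).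
Qed.

Lemma odd_of_mod8 n v : odd v -> n = v %[mod 8] -> odd n.
Proof. lia. Qed.

(** At the odd primes that do not divide both [n] and [a b c], a terminal form
    represents [n] automatically. *)
Lemma terminal_rep a b c v n : terminal a b c -> oreg a b c -> rep a b c v ->
  odd v -> n = v %[mod 8] ->
  (forall q, prime q -> odd q -> q %| n -> q %| a * b * c -> loc q a b c n) ->
  rep a b c n.
Proof.
move=> tm h [x [y [z E]]] ov nv hq.
have on := odd_of_mod8 ov nv.
apply: h => // q pq; have [q2|oq] := even_prime pq.
  rewrite q2; apply: (@loc_two _ _ _ _ x y z) => //.
  by rewrite int_square_sum E -eqz_mod_dvd !modz_nat nv.
have [qn|qn] := boolP (q %| n); last exact: terminal_loc_unit.
have [qD|] := boolP (q %| a * b * c); first exact: hq.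
rewrite !Euclid_dvdM // !negb_or => /andP[/andP[qa qb] qc].
exact: loc_good.
Qed.

Lemma rep_ge_first a b c n : a <= b -> b <= c -> 0 < n -> rep a b c n -> a <= n.
Proof.
move=> ab bc n0 [x [y [z E]]].
have le u d : a <= d -> d * u ^ 2 <= n -> 0 < u -> a <= n.
  by move=> ad dn u0; apply: leq_trans dn; apply: leq_trans ad _; rewrite leq_pmulr ?expn_gt0 ?u0.
have [x0|x0] := posnP x; last by apply: (le x a); rewrite // -E -addnA leq_addr.
have [y0|y0] := posnP y; last by apply: (le y b); rewrite // -E addnAC leq_addl.
have [z0|z0] := posnP z.
  by move: n0; rewrite -E x0 y0 z0 !muln0.
by apply: (le z c); rewrite ?(leq_trans ab) // -E leq_addl.
Qed.

Lemma rep_lt_third a b c n : n < c -> rep a b c n ->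
  exists x y, a * x ^ 2 + b * y ^ 2 = n.
Proof.
move=> nc [x [y [z E]]]; exists x, y.
have [z0|z0] := posnP z; first by rewrite -E z0 muln0 addn0.
suff : c <= n by rewrite leqNgt nc.
by rewrite -E; apply: leq_trans (leq_addl _ _); rewrite leq_pmulr ?expn_gt0 ?z0.
Qed.

Lemma rep_lt_second a b c n : b <= c -> n < b -> rep a b c n ->
  exists x, a * x ^ 2 = n.
Proof.
move=> bc nb /(rep_lt_third (leq_trans nb bc))[x [y E]]; exists x.
have [y0|y0] := posnP y; first by rewrite -E y0 muln0 addn0.
suff : b <= n by rewrite leqNgt nb.
by rewrite -E; apply: leq_trans (leq_addl _ _); rewrite leq_pmulr ?expn_gt0 ?y0.
Qed.

(** * Residues missed by binary forms *)

(** Squaring is not injective on the residues, as [1] and [p - 1] collide, so it is not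
    surjective. *)
Lemma nonresidue p a : prime p -> odd p -> ~~ (p %| a) ->
  exists2 t, t < p & forall y, a * y ^ 2 <> t %[mod p].
Proof.
move=> pp op pa; have p0 := prime_gt0 pp; have p1 := prime_gt1 pp.
pose f (y : 'I_p) := Ordinal (ltn_pmod (a * y ^ 2) p0).
have [/forallP sur|] := boolP [forall t, t \in codom f]; last first.
  rewrite negb_forall => /existsP[t /negP ht]; exists t => // y E; case: ht.
  apply/codomP; exists (Ordinal (ltn_pmod y p0)); apply: val_inj => /=.
  by rewrite -modnMmr modnXm modnMmr E modn_small.
have inj : {in predT &, injective f}.
  apply/image_injP/eqP/eq_card => t; exact: sur.
have p2 : 2 < p by case: (even_prime pp) op p1 => [->//|]; lia.
have pm : p.-1 < p by rewrite prednK.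
have /(congr1 val) /= : Ordinal p1 = Ordinal pm; last by lia.
apply: inj => //; apply: val_inj => /=; apply/eqP.
rewrite exp1n muln1 eq_sym eqn_mod_dvd; last by rewrite leq_pmulr // expn_gt0; lia.
rewrite -{2}[a]muln1 -mulnBr -{2}(exp1n 2) subn_sqr addn1 prednK //.
by rewrite mulnA dvdn_mull.
Qed.

(** For [D = 1] and [D = 2], the kernel of the quadratic character of [Q(sqrt(- D))],
    as a set of residues modulo 8. *)
Definition character_kernel D := [:: 1; if D == 1 then 5 else 3].

(** The kernel is closed under multiplication modulo 8. *)
Lemma mem_character_kernel D n : 0 < D <= 2 -> odd n ->
  (forall q, prime q -> q %| n -> q %% 8 \in character_kernel D) ->
  n %% 8 \in character_kernel D.
Proof.
move=> hD; elim/ltn_ind: n => n IH on hn.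
have [n1|n1] := leqP n 1; first by have -> : n = 1 by case: n n1 on {IH hn} => [|[]].
have pp := pdiv_prime n1; have pd := pdiv_dvd n.
have := hn _ pp pd; set p := pdiv n in pp pd *.
have [m Em] := dvdnP pd => hp.
have om : odd m by move: on; rewrite Em oddM => /andP[].
have : m %% 8 \in character_kernel D.
  apply: IH => //; last by move=> q pq qm; apply: hn => //; rewrite Em dvdn_mulr.
  by rewrite Em ltn_Pmulr ?prime_gt1 //; case: m om {Em}.
rewrite Em -modnMm; move: hp; rewrite !inE.
have /orP[] : (D == 1) || (D == 2) by lia.
  by move=> /eqP ->; case/orP => /eqP -> /orP[] /eqP ->.
by move=> /eqP ->; case/orP => /eqP -> /orP[] /eqP ->.
Qed.

(** Replacing [t] by [t %% q] or by its opposite, one may assume that [t < q] and that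
    [t + D] is odd.  Then the cofactor of [q] in [t ^ 2 + D] is odd and smaller than
    [q]; by induction its residue modulo 8 lies in the kernel, like that of
    [t ^ 2 + D] itself. *)
Lemma prime_dvd_sqr_add D q t : 0 < D <= 2 -> prime q -> odd q ->
  q %| t ^ 2 + D -> q %% 8 \in character_kernel D.
Proof.
move=> hD; elim/ltn_ind: q t => q IH t pq oq qt.
have q0 := prime_gt0 pq.
have q3 : 2 < q by case: (even_prime pq) oq (prime_gt1 pq) => [->//|]; lia.
have [s [sq os qs]] : exists s, [/\ s < q, odd (s + D) & q %| s ^ 2 + D].
  have d1 : q %| (t %% q) ^ 2 + D.
    by rewrite /dvdn -modnDml modnXm modnDml.
  have lt := ltn_pmod t q0; set s := t %% q in d1 lt.
  have [o|o] := boolP (odd (s + D)); first by exists s.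
  have [s0|s0] := posnP s.
    have D2 : D = 2 by move: o; rewrite s0 add0n; lia.
    have := dvdn_leq _ d1; rewrite s0 D2 /=; lia.
  exists (q - s); split; first by rewrite ltn_subrL s0.
    by move: o oq lt; clear; lia.
  rewrite -(dvdn_addl _ (dvdn_mull (2 * s) (dvdnn q))).
  have -> : (q - s) ^ 2 + D + 2 * s * q = q ^ 2 + (s ^ 2 + D).
    by rewrite -{2 3}(subnK (ltnW lt)); move: (q - s) => u; ring.
  by rewrite dvdn_addr ?dvdn_exp.
have [m Em] := dvdnP qs.
have on : odd (s ^ 2 + D) by move: os; rewrite !oddD oddX.
have om : odd m by move: on; rewrite Em oddM => /andP[].
have m8 : m %% 8 \in character_kernel D.
  apply: mem_character_kernel => // r pr rm.
  have ro : odd r by apply: dvdn_odd om.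
  apply: (IH r _ s) => //; last by rewrite Em dvdn_mulr.
  apply: leq_ltn_trans (dvdn_leq _ rm) _; first by case: m om {Em rm}.
  rewrite -(ltn_pmul2r q0) -Em.
  have : s ^ 2 <= q.-1 ^ 2 by rewrite leq_exp2r // -ltnS prednK.
  have -> : q * q = q.-1 ^ 2 + 2 * q.-1 + 1.
    by rewrite -{1 2}(prednK q0) mulnn -addn1 sqrnD; lia.
  by lia.
have n8 : (s ^ 2 + D) %% 8 \in character_kernel D.
  rewrite -modnDml -modnXm; move: os; rewrite oddD !inE.
  have : s %% 8 < 8 by rewrite ltn_mod.
  have <- : odd (s %% 8) = odd s by lia.
  have /orP[] : (D == 1) || (D == 2) by lia.
    by move=> /eqP ->; move: (s %% 8); do 8![case=> //].
  by move=> /eqP ->; move: (s %% 8); do 8![case=> //].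
have q8 : q %% 8 < 8 by rewrite ltn_mod.
have oq8 : odd (q %% 8) by move: oq; lia.
move: m8 n8; rewrite Em -modnMm !inE.
have /orP[] : (D == 1) || (D == 2) by lia.
  by move=> /eqP -> /orP[] /eqP ->; move: (q %% 8) q8 oq8; do 8![case=> //].
by move=> /eqP -> /orP[] /eqP ->; move: (q %% 8) q8 oq8; do 8![case=> //].
Qed.

(** * A priori bounds on the coefficients *)

Lemma sieve_progression (P : seq nat) M s : 0 < M -> all prime P ->
  {in P, forall q, q %| M -> ~~ (q %| s)} ->
  exists n, [/\ n < M * 2 ^ size P, n = s %[mod M] & {in P, forall q, ~~ (q %| n)}].
Proof.
move=> M0 /allP pP hP.
pose P' := [seq q <- P | ~~ (q %| M)].
have [|i il hi] := @sieve P' (s %% M) M M0.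
  by move=> q; rewrite mem_filter => /andP[qM /pP pq]; rewrite pq prime_coprime.
exists (s %% M + M * i); split.
- apply: leq_trans (_ : M * i.+1 <= _); first by rewrite mulnS ltn_add2r ltn_pmod.
  rewrite leq_mul2l; apply/orP; right; apply: leq_trans il _.
  by rewrite leq_exp2l // size_filter count_size.
- by rewrite addnC mulnC modnMDl modn_mod.
move=> q qP; have [qM|qM] := boolP (q %| M); last by apply: hi; rewrite mem_filter qM.
apply: contra (hP q qP qM) => h.
by rewrite /dvdn -(modn_dvdm s qM) -[_ == 0]/(q %| _) -(dvdn_addl _ (dvdn_mulr i qM)).
Qed.

Lemma power_of_two n : 0 < n -> (forall q, prime q -> odd q -> ~~ (q %| n)) ->
  exists j, n = 2 ^ j.
Proof.
elim/ltn_ind: n => n IH n0 h.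
have [on|] := boolP (odd n).
  exists 0; have [n1|n1] := leqP n 1; first by lia.
  by have := h _ (pdiv_prime n1) (dvdn_odd (pdiv_dvd n) on); rewrite pdiv_dvd.
rewrite -dvdn2 => /dvdnP[m E].
have [|||j Ej] := IH m; [by lia|by lia| |by exists j.+1; rewrite expnSr -Ej].
by move=> q pq oq; apply: contra (h q pq oq); rewrite E => /dvdn_mulr.
Qed.

Lemma expn4 k : 4 ^ k = 2 ^ (2 * k). Proof. by rewrite expnM. Qed.
Lemma expn16 k : 16 ^ k = 2 ^ (4 * k). Proof. by rewrite expnM. Qed.

Section CrudeBounds.
Variables (a b c v : nat).
Hypotheses (a0 : 0 < a) (ab : a <= b) (bc : b <= c).
Hypotheses (tm : terminal a b c) (ov : odd v).
Hypothesis represented :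
  forall n, n = v %[mod 8] -> coprime n (a * b * c) -> rep a b c n.

Let P := odd_primes (a * b * c).
Let b0 : 0 < b. Proof. exact: leq_trans a0 ab. Qed.
Let c0 : 0 < c. Proof. exact: leq_trans b0 bc. Qed.
Let abc0 : 0 < a * b * c. Proof. by rewrite !muln_gt0 a0 b0 c0. Qed.
Let pP : all prime P.
Proof. by apply/allP => q; rewrite mem_odd_primes // => /and3P[]. Qed.

Lemma coprime_of_odd_primes n : odd n -> {in P, forall q, ~~ (q %| n)} ->
  coprime n (a * b * c).
Proof.
move=> on h; apply: coprime_no_prime; first by case: n on {h}.
move=> q pq qn qD; suff /h/negP : q \in P by [].
by rewrite mem_odd_primes // pq qD (dvdn_odd qn on).
Qed.

Lemma crude_sieve M s : 8 %| M -> 0 < M -> s = v %[mod 8] ->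
  {in P, forall q, q %| M -> ~~ (q %| s)} ->
  exists n, [/\ n < M * 2 ^ size P, n = s %[mod M], 0 < n,
     coprime n (a * b * c) & rep a b c n].
Proof.
move=> M8 M0 sv hs; have [n [nl ns hn]] := sieve_progression M0 pP hs.
have nv : n = v %[mod 8] by rewrite -sv -(modn_dvdm n M8) ns modn_dvdm.
have on := odd_of_mod8 ov nv.
have cn := coprime_of_odd_primes on hn.
by exists n; split=> //; [case: n on {nl ns hn nv cn}|apply: represented].
Qed.

Lemma crude_first : a < 8 * 2 ^ size P.
Proof.
have [|n [nl _ n0 _ r]] := @crude_sieve 8 v (dvdnn 8) isT erefl.
  move=> q qP; rewrite -[8]/(2 ^ 3) Euclid_dvdX ?(allP pP) // andbT dvdn_prime2 ?(allP pP q) //.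
  by move: qP; rewrite mem_odd_primes // => /and3P[_ oq _] /eqP q2; rewrite q2 in oq.
exact: leq_ltn_trans (rep_ge_first ab bc n0 r) nl.
Qed.

(** An [n] with [n = 2] modulo 3 is not a square, which settles [a = 1]; otherwise
    [n] is not some [a x^2] because it is coprime to [a]. *)
Lemma crude_second : b < 24 * 2 ^ size P.
Proof.
pose s := (9 * v + 8) %% 24.
have sv : s = v %[mod 8] by rewrite /s; lia.
have s3 : s %% 3 = 2 by rewrite /s; lia.
have [|n [nl ns n0 cn r]] := @crude_sieve 24 s isT isT sv.
  move=> q qP q24; move: qP; rewrite mem_odd_primes // => /and3P[pq oq _].
  have : q %| 2 ^ 3 * 3 by [].
  rewrite Euclid_dvdM // Euclid_dvdX // (dvdn_prime2 pq (isT : prime 2)).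
  rewrite (dvdn_prime2 pq (isT : prime 3)) => /orP[/andP[/eqP q2]|/eqP ->].
    by rewrite q2 in oq.
  by rewrite /dvdn s3.
apply: leq_ltn_trans nl; rewrite leqNgt; apply/negP => nb.
have [x Ex] := rep_lt_second bc nb r.
have a1 : a = 1.
  apply/eqP; rewrite -dvdn1 -(eqP cn) dvdn_gcd -{1}Ex dvdn_mulr //.
  by rewrite -mulnA dvdn_mulr.
have n3 : n %% 3 = 2 by rewrite -(@modn_dvdm 24 n 3) // ns modn_dvdm.
move: n3; rewrite -Ex a1 mul1n -modnXm.
have : x %% 3 < 3 by rewrite ltn_mod.
by case: (x %% 3) => [|[|[]]].
Qed.

(** Modulo [l] the form [a x^2 + b y^2] has only one variable left, so it misses a
    whole residue class. *)
Lemma crude_third_odd l : prime l -> odd l -> l %| a * b -> c < 8 * b * 2 ^ size P.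
Proof.
move=> pl ol lab.
have l0 := prime_gt0 pl.
have [u [lu hu lb]] : exists u, [/\ ~~ (l %| u),
    forall x y, exists w, a * x ^ 2 + b * y ^ 2 = u * w ^ 2 %[mod l] & l <= b].
  have [tab _ _] := tm; have [la|la] := boolP (l %| a).
    exists b; split; first by apply/negP => /(tab l pl ol la).
      move=> x y; exists y; rewrite -modnDml -modnMml.
      by move/eqP: la => ->; rewrite mul0n mod0n.
    by apply: leq_trans ab; apply: dvdn_leq.
  move: lab; rewrite Euclid_dvdM // (negPf la) /= => lb; exists a; split => //.
    move=> x y; exists x; rewrite -modnDmr -[X in (_ + X) %% _]modnMml.
    by move/eqP: lb => ->; rewrite mul0n mod0n addn0.
  exact: dvdn_leq.
have [t tl ht] := nonresidue pl ol lu.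
have c8l : coprime 8 l by rewrite (@coprimeXl 3 2) // coprime2n.
pose s := chinese 8 l v t.
have sv : s = v %[mod 8] by apply: chinese_modl.
have st : s = t %[mod l] by apply: chinese_modr.
have [|||n [nl ns n0 cn r]] := @crude_sieve (8 * l) s _ _ sv.
- by rewrite dvdn_mulr.
- by rewrite muln_gt0 l0.
- move=> q qP; move: qP; rewrite mem_odd_primes // => /and3P[pq oq _].
  rewrite -[8]/(2 ^ 3) Euclid_dvdM // Euclid_dvdX // (dvdn_prime2 pq (isT : prime 2)).
  rewrite (dvdn_prime2 pq pl).
  move=> /orP[/andP[/eqP q2]|/eqP ->]; first by rewrite q2 in oq.
  apply/negP; rewrite /dvdn st => /eqP t0; apply: (ht 0).
  by rewrite t0 expnS mul0n muln0 mod0n.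
apply: leq_trans (_ : 8 * l * 2 ^ size P <= _); last first.
  by rewrite leq_mul2r leq_mul2l lb !orbT.
apply: leq_ltn_trans nl; rewrite leqNgt; apply/negP => nc.
have [x [y E]] := rep_lt_third nc r.
have [w hw] := hu x y; apply: (ht w).
by rewrite -hw E -(@modn_dvdm (8 * l) n) ?dvdn_mull // ns modn_dvdm ?dvdn_mull.
Qed.
(** When [a * b] is a power of two, all the admissible residue classes may contain
    numbers represented by the binary form.  If [- a * b] is not a square modulo an
    odd prime [q], however, the binary form represents no multiple of [q] except the
    multiples of [q ^ 2].  Such a [q] is found among the prime factors of a number
    congruent to [7] modulo 8, which lies outside the character kernels. *)
Lemma crude_third_even : (forall q, prime q -> odd q -> ~~ (q %| a * b)) ->
  c < 8 * b * 2 ^ size P \/ a = 1 /\ c < 128 * 4 ^ size P.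
Proof.
move=> hab.
have nonP q : q %| 8 -> q \notin P.
  move=> q8; apply/negP; rewrite mem_odd_primes // => /and3P[pq oq _].
  move: q8; rewrite -[8]/(2 ^ 3) Euclid_dvdX // andbT (dvdn_prime2 pq (isT : prime 2)).
  by move=> /eqP q2; rewrite q2 in oq.
have [a2|a2] := boolP (2 %| a).
  left; have [|n [nl _ n0 cn r]] := @crude_sieve 8 v (dvdnn 8) isT erefl.
    by move=> q qP /nonP; rewrite qP.
  have on : odd n.
    rewrite -coprime2n coprime_sym; apply: coprime_dvdr cn.
    by rewrite -mulnA dvdn_mulr.
  apply: leq_trans (_ : 8 * 2 ^ size P <= _); last first.
    by rewrite leq_mul2r leq_pmulr ?orbT.
  apply: leq_ltn_trans nl; rewrite leqNgt; apply/negP => nc.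
  have [x [y E]] := rep_lt_third nc r.
  have b2 : ~~ (2 %| b).
    apply: contraL on => b2; rewrite -E oddD !oddM.
    by move: a2 b2; rewrite !dvdn2 => /negbTE -> /negbTE ->.
  have b1 : b = 1.
    have [|j Ej] := @power_of_two b b0.
      by move=> q pq oq; apply: contra (hab q pq oq) => /dvdn_mull.
    by move: b2; rewrite Ej; case: j {Ej} => // j; rewrite expnS dvdn_mulr.
  by move: (dvdn_leq a0 a2) ab; rewrite b1; lia.
have a1 : a = 1.
  have [|j Ej] := @power_of_two a a0.
    by move=> q pq oq; apply: contra (hab q pq oq) => /dvdn_mulr.
  by move: a2; rewrite Ej; case: j {Ej} => // j; rewrite expnS dvdn_mulr.
right; split=> //.
have [j Ej] : exists j, b = 2 ^ j.
  by apply: power_of_two => // q pq oq; apply: contra (hab q pq oq) => /dvdn_mull.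
have [D [e [hD Eb qe]]] : exists D e, [/\ 0 < D <= 2, b = D * e ^ 2
    & forall q, prime q -> odd q -> ~~ (q %| e)].
  exists (2 ^ odd j), (2 ^ j./2); split; first by case: (odd j).
    by rewrite -expnM muln2 -expnD odd_double_half.
  move=> q pq oq; apply/negP; rewrite Euclid_dvdX // (dvdn_prime2 pq (isT : prime 2)).
  by case/andP=> /eqP q2; rewrite q2 in oq.
have [|n1 [n1l n1s hn1]] := @sieve_progression P 8 7 isT pP.
  by move=> q qP /nonP; rewrite qP.
have on1 : odd n1 by apply: odd_of_mod8 n1s.
have [q pq [qn1 qD]] : exists2 q, prime q & q %| n1 /\ q %% 8 \notin character_kernel D.
  have [/allP h|/allPn[q]] := boolP (all (fun q => q %% 8 \in character_kernel D) (primes n1)).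
    suff : n1 %% 8 \in character_kernel D.
      by rewrite n1s; case: (D) hD => [|[|[]]].
    apply: mem_character_kernel => // q pq qn1; apply: h.
    by rewrite mem_primes pq qn1; case: n1 on1 {n1l n1s hn1 qn1}.
  by rewrite mem_primes => /and3P[pq _ qn1] hq; exists q.
have oq : odd q := dvdn_odd qn1 on1.
have qP : q \notin P by apply: contraL qn1 => /hn1.
have qabc : ~~ (q %| a * b * c).
  by apply: contra qP => qabc; rewrite mem_odd_primes // pq oq.
have [||n2 [n2l n2s hn2]] := @sieve_progression (q :: P) 8 (v * q) isT.
- by rewrite /= pq.
- move=> r; rewrite inE => /orP[/eqP ->|rP /nonP]; last by rewrite rP.
  rewrite -[8]/(2 ^ 3) Euclid_dvdX // andbT (dvdn_prime2 pq (isT : prime 2)).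
  by move=> /eqP q2; rewrite q2 in oq.
have on2 : odd n2 by apply: (@odd_of_mod8 _ (v * q)); rewrite // oddM ov.
have nv : q * n2 = v %[mod 8].
  have q8 : q ^ 2 = 1 %[mod 8].
    rewrite -modnXm; have : odd (q %% 8) by move: oq; clear; lia.
    have : q %% 8 < 8 by rewrite ltn_mod.
    by move: (q %% 8); do 8![case=> //].
  rewrite -modnMmr n2s modnMmr mulnCA mulnn -modnMmr q8 modnMmr muln1 //.
have cn : coprime (q * n2) (a * b * c).
  rewrite coprimeMl prime_coprime // qabc coprime_of_odd_primes //.
  by move=> r rP; apply: hn2; rewrite inE rP orbT.
apply: leq_ltn_trans (_ : q * n2 < _); last first.
  apply: leq_trans (_ : n1 * (8 * 2 ^ (size P).+1) <= _).
    apply: leq_ltn_trans (_ : n1 * n2 < _).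
      by rewrite leq_mul2r dvdn_leq ?orbT //; case: n1 on1 {n1l n1s hn1 qn1}.
    by rewrite ltn_mul2l n2l andbT; case: n1 on1 {n1l n1s hn1 qn1}.
  apply: leq_trans (_ : 8 * 2 ^ size P * (8 * 2 ^ (size P).+1) <= _).
    by rewrite leq_mul2r (ltnW n1l) orbT.
  by rewrite -[4]/(2 * 2) expnMn expnS; move: (2 ^ size P) => w; lia.
rewrite leqNgt; apply/negP => nc.
have [x [y E]] := rep_lt_third nc (represented nv cn).
move: E; rewrite a1 mul1n Eb -mulnA -expnMn => E.
have qn2 : ~~ (q %| n2) by apply: hn2; rewrite mem_head.
have [qy|qy] := boolP (q %| e * y).
  have qx : q %| x.
    have : q %| x ^ 2.
      rewrite -(dvdn_addl _ (_ : q %| D * (e * y) ^ 2)); last first.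
        by rewrite dvdn_mull // Euclid_dvdX // qy.
      by rewrite E dvdn_mulr.
    by rewrite Euclid_dvdX // andbT.
  case/negP: qn2; rewrite -(dvdn_pmul2l (prime_gt0 pq)) -E mulnn.
  by apply: dvdn_add; [|apply: dvdn_mull]; apply: dvdn_exp2r.
have ey0 : 0 < e * y by rewrite lt0n; apply: contraNneq qy => ->; rewrite dvdn0.
have [[u w] /= huw] : exists u, u.1 * (e * y) - u.2 * q = 1.
  by apply/coprimeP => //; rewrite coprime_sym prime_coprime.
have hu : (u * (e * y)) ^ 2 = 1 %[mod q].
  have -> : u * (e * y) = 1 + w * q by rewrite -huw subnK // ltnW // -subn_gt0 huw.
  by rewrite -modnXm addnC modnMDl modnXm.
have : q %| (x * u) ^ 2 + D.
  rewrite /dvdn -modnDmr -(muln1 D) -modnMmr -hu modnMmr modnDmr.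
  have -> : (x * u) ^ 2 + D * (u * (e * y)) ^ 2 = u ^ 2 * (x ^ 2 + D * (e * y) ^ 2) by ring.
  by rewrite E mulnCA modnMr.
by move/(prime_dvd_sqr_add hD pq oq); rewrite (negPf qD).
Qed.
Lemma crude_third : c < 8 * b * 2 ^ size P \/ a = 1 /\ c < 128 * 4 ^ size P.
Proof.
have [/hasP[l]|/hasPn h] := boolP (has odd (primes (a * b))).
  by rewrite mem_primes => /and3P[pl _ lab] ol; left; apply: crude_third_odd lab.
apply: crude_third_even => q pq oq; apply/negP => qab.
by have := h q; rewrite mem_primes pq qab muln_gt0 a0 b0 oq => /(_ isT).
Qed.

(** The three bounds multiply to less than [2 ^ 16 * 16 ^ k] for [k] odd primes. *)
Lemma crude_product : size P <= 20 /\ a * b * c < 2 ^ 96.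
Proof.
have lt : a * b * c < 2 ^ 16 * 16 ^ size P.
  have := crude_first; have := crude_second; have := crude_third.
  rewrite expn4 expn16 !(mulnC _ (size P)) !(expnM _ (size P)).
  move: (2 ^ size P) => w h hb ha.
  have ab' : a * b <= 8 * w * (24 * w) by apply: leq_mul; apply: ltnW.
  have hc : c < 192 * w ^ 2.
    case: h => [|[_]] h; apply: leq_trans h _; last by rewrite leq_mul2r orbT.
    rewrite -mulnn mulnA leq_mul2r; apply/orP; right.
    by move: hb; clear; lia.
  apply: leq_ltn_trans (leq_mul ab' (leqnn c)) _.
  apply: leq_trans (_ : 8 * w * (24 * w) * (192 * w ^ 2) <= _).
    by rewrite ltn_pmul2l // !muln_gt0; case: (w) ha.
  rewrite (_ : 8 * w * (24 * w) * (192 * w ^ 2) = 8 * 24 * 192 * w ^ 4); last by ring.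
  by apply: leq_mul => //; clear; lia.
have k20 : size P <= 20 := size_odd_primes_20 abc0 lt; split; first exact: k20.
apply: leq_trans lt _; rewrite expn16 -expnD leq_exp2l //.
by move: k20; clear; lia.
Qed.

(** With [a] and [b] bounded by constants, [a b c] is bounded by a constant times
    [2 ^ k] or [4 ^ k], and the number [k] of odd primes drops to 10.  The values 283
    and 337 are those that the enumeration below produces. *)
Lemma crude_refined : a <= 283 -> b <= 337 ->
  c < b * 2 ^ 13 \/ a = 1 /\ c < 2 ^ 27.
Proof.
move=> a283 b337.
have b2 : a * b <= 283 * 337 by apply: leq_mul.
have k10 : size P <= 10.
  case: crude_third => [h|[a1 h]].
    apply: (@size_odd_primes_10 _ (283 * 337 * (8 * 337)) 2 abc0); [by []|by clear; lia|].
    apply: leq_ltn_trans (leq_mul b2 (leqnn c)) _.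
    rewrite -[X in _ < X]mulnA ltn_pmul2l //; apply: leq_trans h _.
    by rewrite leq_mul2r leq_mul2l b337 !orbT.
  apply: (@size_odd_primes_10 _ (337 * 128) 4 abc0); [by []|by clear; lia|].
  apply: leq_ltn_trans (_ : 337 * c < _).
    by rewrite leq_mul2r {1}a1 mul1n b337 orbT.
  by rewrite -mulnA ltn_pmul2l.
case: crude_third => [h|[a1 h]]; [left|right; split=> //]; apply: leq_trans h _.
  rewrite mulnAC mulnC leq_mul2l; apply/orP; right.
  by rewrite -[8]/(2 ^ 3) -expnD leq_exp2l.
rewrite expn4 -[128]/(2 ^ 7) -expnD leq_exp2l //.
by move: k10; clear; lia.
Qed.
End CrudeBounds.

(** * Computing representations *)

Section Computation.
Local Open Scope N_scope.
Local Notation nn := N.to_nat.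
#[local] Arguments N.pow : simpl never.
#[local] Arguments N.mul : simpl never.
#[local] Arguments N.add : simpl never.

(** Unlike [has], [search] stops at the first success under eager evaluation. *)
Fixpoint search (T : Type) (p : T -> bool) (s : seq T) : bool :=
  if s is x :: s' then if p x then true else search p s' else false.

Lemma searchE (T : Type) (p : T -> bool) s : search p s = has p s.
Proof. by elim: s => //= x s ->; case: (p x). Qed.

Fixpoint steps (k : nat) (lo step : N) : seq N :=
  if k is k'.+1 then lo :: steps k' (lo + step) step else [::].

Definition segment (lo hi : N) := steps (nn (hi + 1 - lo)) lo 1.

Lemma mem_segment x lo hi : lo <= x -> x <= hi -> x \in segment lo hi.
Proof.
move=> lx xh; rewrite /segment; have : (nn x < nn lo + nn (hi + 1 - lo))%N by lia.
move: (nn (hi + 1 - lo)) => k; elim: k lo lx {xh} => [|k IH] lo lx h; first by lia.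
rewrite /= inE; case: eqP => //= ne.
by apply: IH; lia.
Qed.

(** The multiples [a x^2], [a (x + 1)^2], ... up to [X], computed with additions only:
    [cur = a x^2], and [step = a (2 x + 1)] grows by [d = 2 a]. *)
Fixpoint squares_from (fuel : nat) (X step cur d : N) : seq N :=
  if fuel is f.+1 then
    if cur <=? X then cur :: squares_from f X (step + d) (cur + step) d else [::]
  else [::].

(** The fuel allows [x < 128], which is enough for [X < 16384 = 128 ^ 2]. *)
Definition square_multiples a X := squares_from 128 X a 0 (2 * a).

Lemma square_multiplesE a X : square_multiples a X =
  squares_from 128 X (a * (2 * 0 + 1)) (a * 0 ^ 2) (2 * a).
Proof. by rewrite /square_multiples N.mul_0_r N.add_0_l N.mul_1_r N.mul_0_r. Qed.

Lemma squares_fromS f a X x :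
  squares_from f X (a * (2 * x + 1) + 2 * a) (a * x ^ 2 + a * (2 * x + 1)) (2 * a) =
  squares_from f X (a * (2 * (x + 1) + 1)) (a * (x + 1) ^ 2) (2 * a).
Proof. by congr (squares_from _ _ _ _ _); rewrite ?N.pow_2_r; lia. Qed.

Lemma square_multiplesP a X u : u \in square_multiples a X ->
  u <= X /\ exists x, u = a * x ^ 2.
Proof.
rewrite square_multiplesE; elim: 128%N 0 => [//|f IH] x /=.
case: N.leb_spec => // le; rewrite inE squares_fromS.
by case/orP=> [/eqP -> |/IH //]; split=> //; exists x.
Qed.

Lemma mem_squares_from f a X x y : 0 < a -> a * x ^ 2 <= X ->
  y <= x -> (nn x < f + nn y)%N ->
  a * x ^ 2 \in squares_from f X (a * (2 * y + 1)) (a * y ^ 2) (2 * a).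
Proof.
move=> a0 le; elim: f y => [|f IH] y yx h; first by lia.
have [E|ne] := eqVneq x y.
  by rewrite -E /=; case: N.leb_spec => [_|lt]; [rewrite mem_head|lia].
rewrite /= squares_fromS; case: N.leb_spec => [_|lt]; last first.
  by have := N.mul_le_mono_l _ _ a (N.pow_le_mono_l _ _ 2 yx); lia.
by rewrite inE IH ?orbT //; lia.
Qed.

Lemma mem_square_multiples a X x : 0 < a -> a * x ^ 2 <= X -> X < 16384 ->
  a * x ^ 2 \in square_multiples a X.
Proof.
move=> a0 le X_lt; rewrite square_multiplesE; apply: mem_squares_from => //.
  by lia.
have : x < 128 by move: le X_lt; rewrite N.pow_2_r; nia.
by lia.
Qed.

Definition rep1 a n := search (N.eqb n) (square_multiples a n).
Definition rep2 a b n := search (fun u => rep1 b (n - u)) (square_multiples a n).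
Definition rep3 a b c n := search (fun u => rep2 b c (n - u)) (square_multiples a n).

Lemma to_nat_sq a x : nn (a * x ^ 2) = (nn a * nn x ^ 2)%N.
Proof. by rewrite N.pow_2_r; lia. Qed.

Lemma rep1_complete a n x : 0 < a -> n < 16384 -> (nn a * x ^ 2)%N = nn n -> rep1 a n.
Proof.
move=> a0 nl E; rewrite /rep1 searchE; apply/hasP; exists n; last by rewrite N.eqb_refl.
have -> : n = a * N.of_nat x ^ 2 by apply: N2Nat.inj; rewrite to_nat_sq Nat2N.id.
by apply: mem_square_multiples => //; have := to_nat_sq a (N.of_nat x); rewrite Nat2N.id; lia.
Qed.

Lemma rep2_complete a b n x y : 0 < a -> 0 < b -> n < 16384 ->
  (nn a * x ^ 2 + nn b * y ^ 2)%N = nn n -> rep2 a b n.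
Proof.
move=> a0 b0 nl E; rewrite /rep2 searchE; apply/hasP.
have Ex := to_nat_sq a (N.of_nat x); rewrite Nat2N.id in Ex.
exists (a * N.of_nat x ^ 2); first by apply: mem_square_multiples => //; lia.
by apply: (@rep1_complete _ _ y) => //; lia.
Qed.

Lemma rep3_complete a b c n : 0 < a -> 0 < b -> 0 < c -> n < 16384 ->
  rep (nn a) (nn b) (nn c) (nn n) -> rep3 a b c n.
Proof.
move=> a0 b0 c0 nl [x [y [z E]]]; rewrite /rep3 searchE; apply/hasP.
have Ex := to_nat_sq a (N.of_nat x); rewrite Nat2N.id in Ex.
exists (a * N.of_nat x ^ 2); first by apply: mem_square_multiples => //; lia.
by apply: (@rep2_complete _ _ _ y z) => //; lia.
Qed.

Lemma rep3_sound a b c n : rep3 a b c n -> rep (nn a) (nn b) (nn c) (nn n).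
Proof.
rewrite /rep3 searchE => /hasP[u /square_multiplesP[ul [x Ex]]].
rewrite /rep2 searchE => /hasP[w /square_multiplesP[wl [y Ey]]].
rewrite /rep1 searchE => /hasP[s /square_multiplesP[sl [z Ez]]].
move=> /N.eqb_spec Es; exists (nn x), (nn y), (nn z).
by rewrite -!to_nat_sq -Ex -Ey -Ez; lia.
Qed.

(** * Prime factors and local tests *)

Lemma to_nat_mod x y : y <> 0 -> nn (x mod y) = (nn x %% nn y)%N.
Proof.
move=> y0; have lt := N.mod_lt x y y0.
have -> : nn x = (nn (x / y) * nn y + nn (x mod y))%N.
  by rewrite {1}(N.div_mod x y y0) N.mul_comm; lia.
by rewrite modnMDl modn_small //; lia.
Qed.

Lemma mod_eq0 x y : y <> 0 -> (x mod y =? 0) = (nn y %| nn x)%N.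
Proof.
move=> y0; rewrite /dvdn -to_nat_mod //.
by case: N.eqb_spec => [->|]; lia.
Qed.

Lemma div_exact x q k : q <> 0 -> nn x = (k * nn q)%N -> x / q = N.of_nat k.
Proof. by move=> q0 E; symmetry; apply: N.div_unique_exact => //; lia. Qed.

Lemma dvdnP_N p x : (p %| nn x)%N -> exists z, x = z * N.of_nat p.
Proof.
by case/dvdnP=> k E; exists (N.of_nat k); apply: N2Nat.inj; rewrite E; lia.
Qed.

Lemma dvdn_gcd_N p x y : (p %| nn x)%N -> (p %| nn y)%N -> (p %| nn (N.gcd x y))%N.
Proof.
move=> /dvdnP_N px /dvdnP_N py; have [z ->] := N.gcd_greatest x y (N.of_nat p) px py.
by apply/dvdnP; exists (nn z); lia.
Qed.

Lemma coprime_N x y : 0 < x -> N.gcd x y =? 1 -> coprime (nn x) (nn y).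
Proof.
move=> x0 /N.eqb_spec g; apply: coprime_no_prime; first by lia.
move=> q pq qx qy; have := dvdn_gcd_N qx qy; rewrite g dvdn1 => /eqP q1.
by rewrite q1 in pq.
Qed.

(** Each pair [(n, q)] of the list stands for a number [n] whose prime factors are at
    least [q].  The [n] accepted by [ok] are collected until the product of
    their [q] exceeds [C].  When the list is exhausted, [C] itself is a correct
    bound. *)
Fixpoint greedy (ok : N -> bool) (l : seq (N * N)) (prod C : N) : N :=
  if l is (n, q) :: l' then
    if ok n then
      let prod' := prod * q in if C <? prod' then n else greedy ok l' prod' C
    else greedy ok l' prod C
  else C.

Definition valid_candidates r (l : seq (N * N)) :=
  all (fun x => [&& x.1 mod 8 =? r, 0 <? x.1, x.1 <? 16384 &
         all (fun d => ~~ (x.1 mod d =? 0)) (segment 2 (x.2 - 1))]) l &&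
  pairwise (fun x y => (x.1 <? y.1) && (N.gcd x.1 y.1 =? 1)) l.

Lemma valid_candidatesP r n q l : valid_candidates r l -> (n, q) \in l ->
  [/\ n mod 8 = r, 0 < n, n < 16384 & forall p, prime p -> (p %| nn n)%N -> (nn q <= p)%N].
Proof.
move=> /andP[/allP h _] /h /and4P[/N.eqb_spec r8 /N.ltb_spec0 n0 /N.ltb_spec0 nl /allP hd].
split=> // p pp pn; rewrite leqNgt; apply/negP => pq.
have p1 := prime_gt1 pp.
have /hd : N.of_nat p \in segment 2 (q - 1) by apply: mem_segment; lia.
by rewrite mod_eq0 ?Nat2N.id ?pn //; lia.
Qed.

Lemma greedy_ge ok l P C d : d <= C -> (forall x, x \in l -> d <= x.1) -> d <= greedy ok l P C.
Proof.
move=> dC; elim: l P => [//|[n q] l IH] P h /=.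
have h' x : x \in l -> d <= x.1 by move=> xl; apply: h; rewrite inE xl orbT.
case: (ok n); last exact: IH.
case: N.ltb_spec => _; last exact: IH.
by apply: (h (n, q)); rewrite mem_head.
Qed.

(** Here [d] is a coefficient and [X] the part of [a b c] that is not already known.  If
    [d] exceeded the returned value, each of the pairwise coprime numbers collected
    would have a prime factor in common with [X]; these primes are distinct, so [X]
    would be larger than [C]. *)
Lemma greedy_bound r (ok : N -> bool) (l : seq (N * N)) C d X : valid_candidates r l ->
  (0 < X)%N -> (X <= nn C)%N -> (nn d <= X)%N ->
  (forall n q, (n, q) \in l -> ok n -> n < d ->
     exists2 p, prime p & (p %| nn n)%N /\ (p %| X)%N) ->
  d <= greedy ok l 1 C.
Proof.
move=> vl X0 XC dX hit.
have dC : d <= C by lia.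
have hv n q := @valid_candidatesP r n q l vl.
move: vl => /andP[_ pw].
suff gen P : (exists D, [/\ (D %| X)%N, (nn P <= D)%N &
    forall x, x \in l -> coprime D (nn x.1)]) -> d <= greedy ok l P C.
  by apply: gen; exists 1%N; split=> // x _; rewrite coprime1n.
elim: l P pw hit hv => [//|[n q] l IH] P /= /andP[/allP rel pw] hit hv [D [DX PD copD]].
have sub x : x \in l -> x \in (n, q) :: l by move=> xl; rewrite inE xl orbT.
have [_ n0 _ hq] := hv n q (mem_head _ _).
have IH' P' : (exists D, [/\ (D %| X)%N, (nn P' <= D)%N & forall x, x \in l -> coprime D (nn x.1)]) ->
    d <= greedy ok l P' C.
  by move=> hD; apply: IH => // n' q' /sub xl; [exact: (hit _ _ xl)|exact: (hv _ _ xl)].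
case okn: (ok n); last first.
  by apply: IH'; exists D; split=> // x /sub; apply: copD.
have [dn|nd] := N.le_gt_cases d n.
  case: N.ltb_spec => // _; apply: greedy_ge => // x /rel /andP[/N.ltb_spec0 /= lt _].
  by lia.
have [p pp [pn pX]] := hit n q (mem_head _ _) okn nd.
have copDn := copD _ (mem_head _ _); rewrite /= in copDn.
have Dp : (D * p %| X)%N.
  rewrite Gauss_dvd ?DX // coprime_sym prime_coprime //.
  apply/negP => pD; have : (p %| gcdn D (nn n))%N by rewrite dvdn_gcd pD.
  by rewrite (eqP copDn) dvdn1 => /eqP p1; rewrite p1 in pp.
have PDp : (nn (P * q) <= D * p)%N.
  by rewrite N2Nat.inj_mul; apply: leq_mul => //; apply: hq.
case: N.ltb_spec => [lt|_].
  by have := dvdn_leq X0 Dp; lia.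
apply: IH'; exists (D * p)%N; split=> // x xl.
rewrite coprimeMl copD ?sub //= prime_coprime //; apply/negP => px.
have /andP[_ g] := rel x xl; have := coprime_N n0 g => /= /eqP cop.
have : (p %| gcdn (nn n) (nn x.1))%N by rewrite dvdn_gcd pn.
by rewrite cop dvdn1 => /eqP p1; rewrite p1 in pp.
Qed.

(** Sufficient conditions for [<a, b, c>] to represent [m] over [Z_q] when [q] divides
    only the third coefficient: the binary form [<a, b>] is isotropic, or [q] divides
    [c] and [m] exactly once and [c / q], [m / q] are in the same square class. *)
Definition residue_test q a b c m :=
  if a mod q =? 0 then false else if b mod q =? 0 then false else
  if search (fun x => (a * x * x + b) mod q =? 0) (segment 1 (q - 1)) then true else
  let c' := c / q in let m' := m / q in
  if negb (c mod q =? 0) then false else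
  if negb (m mod q =? 0) then false else
  if c' mod q =? 0 then false else if m' mod q =? 0 then false else
  search (fun x => (c' * x * x) mod q =? m' mod q) (segment 1 (q - 1)).

Definition local_test q a b c m :=
  if a mod q =? 0 then residue_test q b c a m
  else if b mod q =? 0 then residue_test q a c b m
  else residue_test q a b c m.

Lemma residue_testP q a b c m : prime (nn q) -> odd (nn q) ->
  residue_test q a b c m -> loc (nn q) (nn a) (nn b) (nn c) (nn m).
Proof.
move=> pq oq; have q1 := prime_gt1 pq; have q0 : q <> 0 by lia.
rewrite /residue_test !mod_eq0 //; case: ifPn => // qa; case: ifPn => // qb.
rewrite !searchE; case: ifPn => [/hasP[x _]|_].
  rewrite mod_eq0 // => h _; apply: (@loc_split _ _ _ _ _ (nn x)) => //.
  by rewrite (_ : (_ + _)%N = nn (a * x * x + b)) //; lia.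
case: ifPn => //; rewrite negbK => /dvdnP[c' Ec].
case: ifPn => //; rewrite negbK => /dvdnP[m' Em].
have -> : c / q = N.of_nat c' by apply: div_exact.
have -> : m / q = N.of_nat m' by apply: div_exact.
rewrite !Nat2N.id; case: ifPn => // qc; case: ifPn => // qm /hasP[x _ /N.eqb_spec E].
rewrite Ec Em !(mulnC _ (nn q)).
apply: (@loc_ramified _ _ _ _ _ (nn x)) => //.
have /(congr1 nn) := E; rewrite !to_nat_mod // !Nat2N.id => <-.
by congr (_ %% _)%N; lia.
Qed.

Lemma local_testP q a b c m : prime (nn q) -> odd (nn q) ->
  local_test q a b c m -> loc (nn q) (nn a) (nn b) (nn c) (nn m).
Proof.
move=> pq oq; rewrite /local_test; case: ifP => _.
  by move/(residue_testP pq oq) => /locC13/locC12/locC13; apply: locC12.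
case: ifP => _; last exact: residue_testP.
by move/(residue_testP pq oq) => /locC12/locC13/locC12.
Qed.

(** Trial division by odd numbers: the divisors [d] that reach [t] are the prime
    factors of [g]. *)
Fixpoint prime_factors_test (fuel : nat) (t : N -> bool) (d g : N) : bool :=
  if fuel is f.+1 then
    if g =? 1 then true else
    if g mod d =? 0 then
      if t d then prime_factors_test f t d (g / d) else false
    else prime_factors_test f t (d + 2) g
  else false.

Lemma prime_factors_testP f t d g : prime_factors_test f t d g ->
  odd (nn d) -> odd (nn g) -> (forall p, prime p -> p %| nn g -> nn d <= p)%N ->
  (forall p, prime (nn p) -> nn p %| nn g -> t p)%N.
Proof.
elim: f d g => //= f IH d g; case: N.eqb_spec => [-> _ _ _ _ p pp|_].
  by rewrite dvdn1 => /eqP p1; rewrite p1 in pp.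
move=> + od og hd; have d0 : d <> 0 by move=> d0; rewrite d0 in od.
rewrite mod_eq0 //; case: ifPn => [dg|dg h p pp pg]; last first.
  apply: (IH _ _ h) => //; first by move: od; clear; lia.
  move=> r pr rg; have := hd r pr rg.
  have ro := dvdn_odd rg og.
  have : r <> nn d by move=> E; rewrite -E rg in dg.
  by move: od ro; clear; lia.
case: ifPn => // td h p pp pg.
have [g' Eg] := dvdnP dg.
have E : g / d = N.of_nat g' by apply: div_exact.
have og' : odd g' by move: og; rewrite Eg oddM => /andP[].
move: pg; rewrite Eg Euclid_dvdM // => /orP[pg'|pd].
  apply: (IH _ _ h) => //; rewrite E ?Nat2N.id //.
  by move=> r pr rg; apply: hd => //; rewrite Eg dvdn_mulr.
suff -> : p = d by [].
have d1 : (0 < nn d)%N by lia.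
by have := dvdn_leq d1 pd; have := hd _ pp (dvdn_trans pd dg); lia.
Qed.

(** * The table of candidates *)

(** The coefficients are in increasing order. *)
Definition table : seq (N * N * N) :=
  [:: (1,1,1); (1,1,2); (1,1,3); (1,1,4); (1,1,5); (1,1,6);
   (1,1,8); (1,1,9); (1,1,12); (1,1,16); (1,1,21); (1,1,24);
   (1,1,36); (1,2,2); (1,2,3); (1,2,4); (1,2,5); (1,2,6);
   (1,2,8); (1,2,10); (1,2,16); (1,2,24); (1,2,32); (1,3,3);
   (1,3,4); (1,3,6); (1,3,9); (1,3,10); (1,3,12); (1,3,18);
   (1,3,30); (1,3,36); (1,3,54); (1,4,4); (1,4,5); (1,4,6);
   (1,4,8); (1,4,9); (1,4,12); (1,4,16); (1,4,21); (1,4,24);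
   (1,4,36); (1,5,5); (1,5,8); (1,5,10); (1,5,12); (1,5,20);
   (1,5,25); (1,5,40); (1,5,60); (1,5,100); (1,6,6); (1,6,8);
   (1,6,9); (1,6,16); (1,6,18); (1,6,24); (1,6,72); (1,8,8);
   (1,8,16); (1,8,24); (1,8,32); (1,8,40); (1,8,64); (1,9,9);
   (1,9,12); (1,9,21); (1,9,24); (1,9,36); (1,9,108); (1,10,30);
   (1,10,120); (1,12,12); (1,12,21); (1,12,36); (1,12,45); (1,16,16);
   (1,16,24); (1,16,48); (1,16,72); (1,18,24); (1,21,21); (1,21,28);
   (1,21,84); (1,24,24); (1,24,72); (1,24,144); (1,30,40); (1,40,120);
   (1,45,60); (1,48,144); (2,2,3); (2,3,3); (2,3,6); (2,3,8);
   (2,3,9); (2,3,12); (2,3,18); (2,3,24); (2,3,48); (2,3,72);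
   (2,5,6); (2,5,10); (2,5,15); (2,5,24); (2,6,9); (2,6,15);
   (2,9,24); (2,15,24); (3,3,4); (3,3,7); (3,3,8); (3,4,4);
   (3,4,7); (3,4,12); (3,4,15); (3,4,27); (3,4,36); (3,6,8);
   (3,7,7); (3,7,12); (3,7,28); (3,7,63); (3,7,84); (3,8,8);
   (3,8,12); (3,8,24); (3,8,48); (3,8,72); (3,8,216); (3,10,30);
   (3,10,120); (3,15,20); (3,16,48); (3,30,40); (3,40,120); (5,6,8);
   (5,6,15); (5,8,24); (5,8,40); (5,9,12); (5,9,60); (6,8,9);
   (6,8,15); (8,9,24); (8,15,24)].

(** * Excluding one form *)

Definition odd_numbers : seq N := Eval vm_compute in steps 800 1 2.

(** The odd residues modulo 8 of the values of the form: [0], [1] and [4] are the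
    squares modulo 8, and [N.land u 7] is [u mod 8]. *)
Definition odd_classes a b c : seq N :=
  let squares := [:: 0; 1; 4] in
  [seq s <- [seq N.land (u + c * z) 7 |
               u <- [seq a * x + b * y | x <- squares, y <- squares], z <- squares]
  | N.odd s].

(** Rejects a terminal form by an odd number [m] that it represents locally but not
    globally.  The coefficients are passed to [rep3] in reverse order because its
    outermost loop is the shortest when it runs over the largest coefficient. *)
Definition excluded a b c : bool :=
  let cls := odd_classes a b c in let D := a * b * c in
  search (fun m =>
    if search (N.eqb (N.land m 7)) cls then
      if rep3 c b a m then false else
      prime_factors_test 100 (fun q => local_test q a b c m) 3 (N.gcd m D)
    else false) odd_numbers.

Lemma mem_odd_numbers m : m \in odd_numbers -> odd (nn m) /\ m < 16384.
Proof.
have /allP h : all (fun m => N.odd m && (m <? 16384)) odd_numbers by vm_compute.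
by move=> /h /andP[/N.odd_spec[k ->] /N.ltb_spec0 lt]; split=> //; lia.
Qed.

Lemma land7 x : N.land x 7 = x mod 8.
Proof. exact: (N.land_ones x 3). Qed.

Lemma odd_classesP a b c s : s \in odd_classes a b c ->
  exists2 v, rep (nn a) (nn b) (nn c) v & nn s = (v %% 8)%N.
Proof.
rewrite mem_filter => /andP[_].
case/allpairsP=> [[u z] [/allpairsP[[x y] [hx hy ->]] hz ->]].
exists (nn (a * x + b * y + c * z)); last by rewrite land7 to_nat_mod.
have sq w : w \in [:: 0; 1; 4] -> exists i, nn w = (i ^ 2)%N.
  by rewrite !inE => /or3P[] /eqP ->; [exists 0%N|exists 1%N|exists 2%N].
have [i Ei] := sq _ hx; have [j Ej] := sq _ hy; have [k Ek] := sq _ hz.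
by exists i, j, k; rewrite -Ei -Ej -Ek /=; lia.
Qed.

Lemma excludedP a b c : 0 < a -> 0 < b -> 0 < c ->
  terminal (nn a) (nn b) (nn c) -> excluded a b c -> ~ oreg (nn a) (nn b) (nn c).
Proof.
move=> a0 b0 c0 tm; rewrite /excluded searchE => /hasP[m /mem_odd_numbers[om ml]].
rewrite searchE; case: ifPn => // /hasP[s /odd_classesP[v rv Es] /N.eqb_spec ms].
case: ifPn => // nrep hp h.
have mv : nn m = v %[mod 8] by rewrite -Es -ms land7 to_nat_mod // modn_mod.
have ov : odd v := odd_of_mod8 om (esym mv).
have /negP := nrep; apply; apply: rep3_complete => //.
apply/repC13; apply: (terminal_rep tm h rv ov mv) => q pq oq qm qD.
have -> : q = nn (N.of_nat q) by rewrite Nat2N.id.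
apply: local_testP; rewrite ?Nat2N.id //.
apply: (prime_factors_testP hp) => //; rewrite ?Nat2N.id //.
- have [w /(congr1 nn) E] := N.gcd_divide_l m (a * b * c).
  by apply: dvdn_odd om; apply/dvdnP; exists (nn w); lia.
- move=> p pp pg; have p3 : odd p.
    have [w /(congr1 nn) E] := N.gcd_divide_l m (a * b * c).
    by apply: (dvdn_odd _ om); apply: dvdn_trans pg _; apply/dvdnP; exists (nn w); lia.
  by case: p pp p3 {pg} => [|[|[|]]].
by apply: dvdn_gcd_N => //; rewrite (_ : nn (a * b * c) = (nn a * nn b * nn c)%N) //; lia.
Qed.

(** * Enumeration of the forms with pairwise coprime odd parts *)

(** As far as 337, where the product of the primes exceeds [2 ^ 96] in each class. *)
Definition class_primes (r : N) : seq (N * N) :=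
  let is_prime n := all (fun d => ~~ (n mod d =? 0)) (segment 2 (n - 1)) in
  [seq (n, n) | n <- steps 42 (if r =? 1 then 9 else r) 8 & is_prime n].

Definition primes1 := Eval vm_compute in class_primes 1.
Definition primes3 := Eval vm_compute in class_primes 3.
Definition primes5 := Eval vm_compute in class_primes 5.
Definition primes7 := Eval vm_compute in class_primes 7.

Definition prime_candidates (r : N) : seq (N * N) :=
  if r =? 1 then primes1 else if r =? 3 then primes3
  else if r =? 5 then primes5 else primes7.

Definition products (l : seq (N * N)) : seq (N * N) := [seq (x.1 * x.2, x.1) | x <- l].

(** The form [x^2 + y^2] represents all primes congruent to [1] or [5] modulo 8, but
    products of two distinct primes congruent to [3] modulo 4 are missed by all the
    forms [x^2 + 4^i y^2]. *)
Definition square_candidates (r : N) : seq (N * N) :=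
  if r =? 1 then
    products [:: (3, 11); (7, 23); (19, 43); (31, 47); (59, 67); (71, 79); (83, 107)]
  else if r =? 5 then
    products [:: (3, 7); (11, 23); (19, 31); (43, 47); (59, 71); (67, 79); (83, 103)]
  else prime_candidates r.

(** The form [x^2 + 2 y^2] represents all primes congruent to [1] or [3] modulo 8, but
    products of two distinct primes congruent to [5] or [7] modulo 8 are missed by all
    the forms [x^2 + 2 * 4^i y^2]. *)
Definition twice_square_candidates (r : N) : seq (N * N) :=
  if r =? 1 then
    products [:: (5, 13); (7, 23); (29, 37); (31, 47); (53, 61); (71, 79); (101, 109)]
  else if r =? 3 then
    products [:: (5, 7); (13, 23); (29, 31); (37, 47); (53, 71); (61, 79); (101, 103)]
  else prime_candidates r.

Definition third_candidates (r a b : N) : seq (N * N) :=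
  if a =? 1 then
    if b \in [:: 1; 4; 16; 64; 256] then square_candidates r
    else if b \in [:: 2; 8; 32; 128] then twice_square_candidates r
    else prime_candidates r
  else prime_candidates r.

Definition new_second a n : bool := if N.gcd a n =? 1 then ~~ rep1 a n else false.
Definition new_third a b n : bool :=
  if N.gcd (a * b) n =? 1 then ~~ rep2 a b n else false.

(** A test by a few primes, which skips most of the triples that are not terminal; the
    others are treated like terminal ones. *)
Definition common_prime x y : bool :=
  search (fun p => if x mod p =? 0 then y mod p =? 0 else false) [:: 3; 5; 7; 11; 13].

(** [ns] lists numbers missed by [<a, b>] and coprime to [a b]; one of them that is
    smaller than [c] and coprime to [c] already rejects the triple. *)
Definition check_third r a b (ns : seq N) c : bool :=
  if search (fun n => if n <? c then N.gcd n c =? 1 else false) ns then true else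
  if common_prime a c then true else if common_prime b c then true else
  if (a, b, c) \in table then true else
  if ~~ search (N.eqb r) (odd_classes a b c) then true else excluded a b c.

(** The bound on [c] is iterated, each value serving as the next [C]; it then yields a
    better bound on [b], which discards most pairs.  The initial values come from
    [crude_refined]. *)
Definition check_second r a b : bool :=
  if common_prime a b then true else
  let l := third_candidates r a b in
  let bound C := greedy (new_third a b) l 1 C in
  let C2 := bound (bound (bound (if a =? 1 then 2 ^ 27 else b * 2 ^ 13))) in
  if greedy (new_second a) (prime_candidates r) 1 (b * C2) <? b then true else
  all (check_third r a b [seq n <- [seq x.1 | x <- l & x.1 <? C2] | new_third a b n])
      (segment b C2).

Definition check_first r a : bool :=
  let bound C := greedy (new_second a) (prime_candidates r) 1 C in
  if bound (2 ^ 96) <=? 337 then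
    all (check_second r a)
        (segment a (bound (if a =? 1 then 337 * 2 ^ 27 else 337 * 337 * 2 ^ 13)))
  else false.

Definition first_bound r : N :=
  if r =? 1 then 1 else greedy xpredT (prime_candidates r) 1 (2 ^ 96).

Definition check_class r : bool :=
  if first_bound r <=? 283 then all (check_first r) (segment 1 (first_bound r)) else false.

Lemma check_class_true : all check_class [:: 1; 3; 5; 7].
Proof. by vm_compute. Qed.

Lemma third_candidates_valid r a b : r \in [:: 1; 3; 5; 7] ->
  valid_candidates r (prime_candidates r) && valid_candidates r (third_candidates r a b).
Proof.
have /allP h : all (fun r => [&& valid_candidates r (prime_candidates r),
   valid_candidates r (square_candidates r) &
   valid_candidates r (twice_square_candidates r)]) [:: 1; 3; 5; 7] by vm_compute.
move=> /h /and3P[h1 h2 h3]; rewrite h1 /third_candidates.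
by case: ifP => // _; case: ifP => // _; case: ifP.
Qed.

Lemma not_coprime_prime n m : (0 < n)%N -> ~~ coprime n m ->
  exists2 p, prime p & (p %| n)%N /\ (p %| m)%N.
Proof.
move=> n0; rewrite /coprime neq_ltn ltnS leqn0 eqn0Ngt gcdn_gt0 n0 /= => g1.
by exists (pdiv (gcdn n m)); rewrite ?pdiv_prime // 
  !(dvdn_trans (pdiv_dvd _)) ?dvdn_gcdl ?dvdn_gcdr.
Qed.

Section Terminal.
Variables (r a b c : N).
Hypotheses (a0 : 0 < a) (ab : a <= b) (bc : b <= c).
Hypotheses (tm : terminal (nn a) (nn b) (nn c)).
Hypothesis regular : oreg (nn a) (nn b) (nn c).
Hypothesis r_class : r \in odd_classes a b c.

Let b0 : 0 < b. Proof. by clear -a0 ab; lia. Qed.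
Let c0 : 0 < c. Proof. by clear -b0 bc; lia. Qed.

Lemma odd_class_residue : r \in [:: 1; 3; 5; 7].
Proof.
have [v _ rv] := odd_classesP r_class.
have : (nn r < 8)%N by rewrite rv ltn_mod.
move: r_class; rewrite mem_filter => /andP[/N.odd_spec[k ->] _] lt.
have : k < 4 by lia.
by case: k {lt} => [|[[|p|]|[|p|]|]] //=; lia.
Qed.
Let r_odd := odd_class_residue.

Lemma represented n : n = nn r %[mod 8] -> coprime n (nn a * nn b * nn c) ->
  rep (nn a) (nn b) (nn c) n.
Proof.
have [v rv Er] := odd_classesP r_class; rewrite Er modn_mod => nv cop.
have ov : odd v.
  apply: (@odd_of_mod8 _ (nn r)); last by rewrite Er modn_mod.
  by move: r_odd; rewrite !inE => /or4P[] /eqP ->.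
apply: (terminal_rep tm regular rv ov nv) => q pq _ qn qD.
have : (q %| gcdn n (nn a * nn b * nn c))%N by rewrite dvdn_gcd qn.
by rewrite (eqP cop) dvdn1 => /eqP q1; rewrite q1 in pq.
Qed.

(** A number in the class of [r] that is not represented cannot be coprime to
    [a b c]. *)
Lemma hit_prime (e X : nat) n :
  (nn a * nn b * nn c = e * X)%N -> coprime e (nn n) -> n mod 8 = r -> 0 < n ->
  ~ rep (nn a) (nn b) (nn c) (nn n) ->
  exists2 p, prime p & (p %| nn n)%N /\ (p %| X)%N.
Proof.
move=> E cop nr n0 nrep.
have [||p pp [pn pX]] := @not_coprime_prime (nn n) (e * X); first by lia.
  apply/negP => cp; apply: nrep; apply: represented; last by rewrite E.
  by rewrite -nr to_nat_mod // modn_mod.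
exists p => //; split=> //; move: pX; rewrite Euclid_dvdM // => /orP[pe|//].
have : (p %| gcdn e (nn n))%N by rewrite dvdn_gcd pe.
by rewrite (eqP cop) dvdn1 => /eqP p1; rewrite p1 in pp.
Qed.

Lemma new_third_represented n q : (n, q) \in third_candidates r a b ->
  new_third a b n -> n < c -> ~ rep (nn a) (nn b) (nn c) (nn n).
Proof.
move=> nl; have /andP[_ hv] := third_candidates_valid a b r_odd.
have [nr n0 n_lt _] := valid_candidatesP hv nl.
rewrite /new_third; case: ifP => // g /negP nrep nc rn; apply: nrep.
have [|x [y E]] := rep_lt_third _ rn; first by lia.
exact: rep2_complete E.
Qed.

Lemma third_bound C : c <= C ->
  c <= greedy (new_third a b) (third_candidates r a b) 1 C.
Proof.
move=> cC; have /andP[_ hv] := third_candidates_valid a b r_odd.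
apply: (@greedy_bound _ _ _ _ _ (nn c) hv) => [||//|]; [lia|lia|].
move=> n q nl; have [nr n0 n_lt _] := valid_candidatesP hv nl.
move=> nt nc; have nrep := new_third_represented nl nt nc.
move: nt; rewrite /new_third; case: ifP => // g _.
have ab0 : 0 < a * b by lia.
by apply: (@hit_prime (nn (a * b)) _ _ _ (coprime_N ab0 g)) => //; lia.
Qed.

Lemma second_bound C : b * c <= C ->
  b <= greedy (new_second a) (prime_candidates r) 1 C.
Proof.
move=> bcC; have /andP[hv _] := third_candidates_valid a b r_odd.
have bX : (nn b <= nn b * nn c)%N by rewrite leq_pmulr; lia.
apply: (@greedy_bound _ _ _ _ _ (nn b * nn c) hv) => [||//|]; [lia|lia|].
move=> n q nl; have [nr n0 n_lt _] := valid_candidatesP hv nl.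
rewrite /new_second; case: ifP => // g /negP nrep nb.
apply: (@hit_prime (nn a) _ _ _ (coprime_N a0 g)) => //; first by rewrite mulnA.
move=> rn; apply: nrep.
have [||x E] := rep_lt_second _ _ rn; [lia|lia|].
exact: rep1_complete E.
Qed.

Lemma first_boundP C : a * b * c <= C -> a <= (if r =? 1 then 1 else
  greedy xpredT (prime_candidates r) 1 C).
Proof.
move=> abcC; have lt : (nn a <= nn b)%N by lia.
have lt' : (nn b <= nn c)%N by lia.
case: N.eqb_spec => [r1|_].
  have h : rep (nn a) (nn b) (nn c) 1 by apply: represented; rewrite ?coprime1n // r1.
  by have := rep_ge_first (n := 1%N) lt lt' isT h; clear; lia.
have /andP[hv _] := third_candidates_valid a b r_odd.
have aX : (nn a <= nn a * nn b * nn c)%N by rewrite -mulnA leq_pmulr // muln_gt0; lia.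
apply: (@greedy_bound _ _ _ _ _ (nn a * nn b * nn c) hv) => [||//|]; [lia|lia|].
move=> n q nl; have [nr n0 n_lt _] := valid_candidatesP hv nl.
move=> _ na; apply: (@hit_prime 1) => //; rewrite ?mul1n ?coprime1n //.
by move=> rn; have := rep_ge_first lt lt' _ rn; lia.
Qed.

Lemma common_prime_false x y : odd_coprime (nn x) (nn y) -> common_prime x y = false.
Proof.
move=> h; apply/negP; rewrite /common_prime searchE => /hasP[p hp].
have [pp op] : prime (nn p) /\ odd (nn p).
  by move: hp; rewrite !inE => /or4P[|||/orP[]] /eqP ->.
have p0 : p <> 0 by move=> p0; rewrite p0 in pp.
rewrite !mod_eq0 //; case: ifP => // px py; exact: h px py.
Qed.

(** The sieve justifies the initial values [2 ^ 96] of the enumeration; the resulting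
    bounds on [a] and [b] put [crude_refined] into play, which justifies the
    others. *)
Lemma terminal_in_table : (a, b, c) \in table.
Proof.
have := allP check_class_true r r_odd; rewrite /check_class.
case: N.leb_spec => // a283 /allP h1.
have ov : odd (nn r) by move: r_odd; rewrite !inE => /or4P[] /eqP ->.
have lt0 : (0 < nn a)%N by clear -a0; lia.
have lt : (nn a <= nn b)%N by clear -ab; lia.
have lt' : (nn b <= nn c)%N by clear -bc; lia.
have abc : a * b * c <= 2 ^ 96.
  have [_] := crude_product lt0 lt lt' tm ov represented.
  by clear; lia.
have aA : a <= first_bound r by apply: first_boundP.
have a_le : a <= 283 by clear -aA a283; lia.
have := h1 a (mem_segment _ aA); rewrite /check_first => /(_ ltac:(clear -a0; lia)).
have bc96 : b * c <= 2 ^ 96 by clear -abc a0; nia.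
have b1 := second_bound bc96.
case: N.leb_spec => // b337 /allP h2.
have b_le : b <= 337 by clear -b1 b337; lia.
have third : c < b * 2 ^ 13 \/ a = 1 /\ c < 2 ^ 27.
  have [||h|[a1 h]] := crude_refined lt0 lt lt' tm ov represented.
  - by clear -a_le; lia.
  - by clear -b_le; lia.
  - by left; clear -h; lia.
  by right; clear -h a1; lia.
have cC : c <= if a =? 1 then 2 ^ 27 else b * 2 ^ 13.
  case: N.eqb_spec => a1; case: third => [h|[a1' h]].
  - by clear -h b_le; lia.
  - by clear -h; lia.
  - by clear -h; lia.
  by case: a1.
have bcC : b * c <= if a =? 1 then 337 * 2 ^ 27 else 337 * 337 * 2 ^ 13.
  apply: N.le_trans (N.mul_le_mono _ _ _ _ b_le cC) _.
  by case: N.eqb_spec => _; clear -b_le; lia.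
have := h2 b (mem_segment ab (second_bound bcC)); rewrite /check_second.
have [tab tac tbc] := tm; rewrite common_prime_false //.
have c2 := third_bound (third_bound (third_bound cC)).
move: c2; set C2 := greedy _ _ _ (greedy _ _ _ (greedy _ _ _ _)) => c2.
have bcC2 : b * c <= b * C2 by apply: N.mul_le_mono_l.
have := second_bound bcC2; case: N.ltb_spec => [lt1 lt2|_ _ /allP h3].
  by clear -lt1 lt2; lia.
have := h3 c (mem_segment bc c2); rewrite /check_third !common_prime_false //.
rewrite searchE; case: ifPn => [/hasP[n]|_].
  rewrite mem_filter => /andP[nt /mapP[[n' q]]]; rewrite mem_filter => /andP[_ nl] /= En.
  move: nt; rewrite {n}En => nt; case: N.ltb_spec => // nc g.
  case: (new_third_represented nl nt nc).
  have /andP[_ hv] := third_candidates_valid a b r_odd.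
  have [nr n0 _ _] := valid_candidatesP hv nl.
  apply: represented; first by rewrite -nr to_nat_mod // modn_mod.
  rewrite coprimeMr coprime_N // andbT.
  move: nt; rewrite /new_third; case: ifP => // g' _.
  have -> : (nn a * nn b)%N = nn (a * b) by clear; lia.
  rewrite coprime_sym; apply: coprime_N => //.
  by clear -a0 b0; nia.
case: ifP => // _; case: ifPn => [|_ ex]; last by case: (excludedP a0 b0 c0 tm ex regular).
by rewrite searchE => /hasPn /(_ r r_class); rewrite N.eqb_refl.
Qed.
End Terminal.

(** * Closure of the table under the inverse transformations *)

Definition sort3 (a b c : N) : N * N * N :=
  let '(b, c) := if b <=? c then (b, c) else (c, b) in
  if a <=? b then (a, b, c) else if a <=? c then (b, a, c) else (b, c, a).

Lemma sort3C23 a b c : sort3 a b c = sort3 a c b.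
Proof.
rewrite /sort3; case: (N.leb_spec b c) => h1; case: (N.leb_spec c b) => h2 //; last by lia.
by have -> : b = c by lia.
Qed.

Lemma sort3C12 a b c : sort3 a b c = sort3 b a c.
Proof.
rewrite /sort3; case: (N.leb_spec b c) => h1; case: (N.leb_spec a c) => h2;
case: (N.leb_spec a b) => h3; case: (N.leb_spec b a) => h4 //=;
repeat (case: N.leb_spec => ? //=); try lia; try (have -> : a = b by lia); try done;
try (have -> : b = c by lia); try done; try (have -> : a = c by lia); try done.
Qed.

(** Membership in the table, comparing the coefficients one by one so that evaluation
    stops at the first difference. *)
Definition known (t : N * N * N) : bool :=
  let '(a, b, c) := t in
  search (fun u => let '(x, y, z) := u in
    if a =? x then if b =? y then c =? z else false else false) table.

Lemma knownP t : known t -> t \in table.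
Proof.
case: t => [[a b] c]; rewrite /known searchE => /hasP[[[x y] z] h].
case: N.eqb_spec => // ->; case: N.eqb_spec => // ->.
by case: N.eqb_spec => // ->.
Qed.

Definition odd_primes_168 : seq N := Eval vm_compute in
  [seq n <- steps 83 3 2 | all (fun d => ~~ (n mod d =? 0)) (segment 2 (n - 1))].

Definition small_primes : seq (N * seq N) :=
  [seq (n, [seq (x * x) mod n | x <- segment 1 (n / 2)]) | n <- odd_primes_168].

(** Looks for a number [m] as in [witness_up] and [witness_up_sqr]: [sq] lists the
    squares modulo [p], and [t] tests that the known form represents [m], or
    [p * m]. *)
Definition witness_test p (sq : seq N) a b c (t : N -> bool) : bool :=
  search (fun m =>
    if m mod p =? 0 then false else
    if search (N.eqb ((a * m) mod p)) sq then
      if rep3 c b a m then false else t m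
    else false) odd_numbers.

(** Deals with the forms that the transformations at [p] send to [<a, b, c>].  The two
    transformations are told apart by whether [p] divides [a]; in the first case
    [p] divides [a] exactly once. *)
Definition up_test (ps : N * seq N) a b c : bool :=
  let '(p, sq) := ps in
  if a mod p =? 0 then
    let a' := a / p in
    if a' mod p =? 0 then true else
    if known (sort3 a' (p * b) (p * c)) then true else
    witness_test p sq a' (p * b) (p * c) (fun m => rep3 a b c (p * m))
  else
    if known (sort3 a (p * p * b) (p * p * c)) then true else
    witness_test p sq a (p * p * b) (p * p * c) (rep3 a b c).

(** The only odd primes dividing a coefficient in the table are 3, 5 and 7; this is
    part of what [large_test] verifies. *)
Definition modulus a b c :=
  8 * foldr (fun p s => if (a * b * c) mod p =? 0 then p * s else s) 1 [:: 3; 5; 7].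

(** The hypotheses of [oreg_up_sqr_large].  That a power of [M] is divisible by
    [a * b * c] shows that [M] contains all its prime factors. *)
Definition large_test a b c : bool :=
  let M := modulus a b c in
  [&& M <=? 168, (M ^ 10) mod (a * b * c) =? 0, N.gcd 11 M =? 1, 0 <? a * b * c &
    search (fun v => if N.gcd v M =? 1 then rep3 a b c v else false) odd_numbers].

Definition roles (t : N * N * N) (test : N -> N -> N -> bool) : bool :=
  let '(a, b, c) := t in
  if test a b c then if test b a c then test c a b else false else false.

Lemma table_up_closed :
  all (fun ps => all (fun t => roles t (up_test ps)) table) small_primes.
Proof. by vm_compute. Qed.

Lemma table_large_tests : all (fun t => roles t large_test) table.
Proof. by vm_compute. Qed.

Lemma sort3_roles a b c test : b <= c -> sort3 a b c \in table ->
  (forall t, t \in table -> roles t test) -> test a b c.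
Proof.
move=> bc; rewrite /sort3; case: N.leb_spec; last by lia.
move=> _ + h; case: N.leb_spec => _.
  by move/h; rewrite /roles; case: ifP.
case: N.leb_spec => _ /h; rewrite /roles; case: ifP => // _; case: ifP => //.
Qed.

Lemma mem_small_primes p : prime p -> odd p -> (p <= 168)%N ->
  exists2 sq, (N.of_nat p, sq) \in small_primes &
    forall s, s \in sq -> exists x, s = (x * x) mod (N.of_nat p).
Proof.
move=> pp op ple.
have h : N.of_nat p \in odd_primes_168.
  have /allP/(_ p) : all (fun p => prime p && odd p ==> (N.of_nat p \in odd_primes_168))
    (iota 0 169) by vm_compute.
  by rewrite mem_iota pp op add0n ltnS ple; apply.
exists [seq (x * x) mod N.of_nat p | x <- segment 1 (N.of_nat p / 2)].
  by apply/mapP; exists (N.of_nat p); [exact: h|].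
by move=> s /mapP[x _ ->]; exists x.
Qed.

Lemma modular_inverse x n : (0 < n)%N -> coprime x n -> exists u, (x * u = 1 %[mod n])%N.
Proof.
move=> n0 cop; have [x0|x0] := posnP x.
  move: cop; rewrite x0 /coprime gcd0n => /eqP ->; exists 0%N; by rewrite !modn1.
have /(coprimeP _ x0)[[u v] /= E] := cop.
exists u; have -> : (x * u = 1 + v * n)%N.
  by rewrite -E mulnC subnK // ltnW // -subn_gt0 E.
by rewrite addnC modnMDl.
Qed.

(** From [a m = x^2] modulo [p] and an inverse [u] of [x], one gets
    [a (m u)^2 = m]. *)
Lemma witness_testP p sq a b c t : witness_test p sq a b c t ->
  (forall s, s \in sq -> exists x, s = (x * x) mod p) ->
  prime (nn p) -> ~~ (nn p %| nn a)%N -> 0 < a -> 0 < b -> 0 < c ->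
  exists m x, [/\ odd (nn m), ~~ (nn p %| nn m)%N, (nn a * x ^ 2 = nn m %[mod nn p])%N,
    ~ rep (nn a) (nn b) (nn c) (nn m) & t m].
Proof.
rewrite /witness_test searchE => /hasP[m /mem_odd_numbers[om ml]] + hsq pp pa a0 b0 c0.
have p0 : p <> 0 by move=> p0; rewrite p0 in pp.
rewrite mod_eq0 // searchE; case: ifPn => // pm.
case: ifP => // /hasP[s /hsq[x ->] /N.eqb_spec E].
case: ifPn => // nrep tm; exists m.
have {}E : (nn a * nn m = nn x ^ 2 %[mod nn p])%N.
  move/(congr1 nn): E; rewrite !to_nat_mod // => E.
  by rewrite -(_ : nn (a * m) = (nn a * nn m)%N) 1?E; first congr (_ %% _)%N; lia.
have px : coprime (nn x) (nn p).
  rewrite coprime_sym prime_coprime //; apply/negP => px.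
  have : (nn p %| nn a * nn m)%N by rewrite /dvdn E -/(dvdn _ _) dvdn_exp.
  by rewrite Euclid_dvdM // (negPf pa) (negPf pm).
have [u hu] := modular_inverse (prime_gt0 pp) px.
exists (nn m * u)%N; split=> //.
  have -> : (nn a * (nn m * u) ^ 2 = nn a * nn m * (nn m * u ^ 2))%N by ring.
  rewrite -modnMml E modnMml.
  have -> : (nn x ^ 2 * (nn m * u ^ 2) = nn m * (nn x * u) ^ 2)%N by ring.
  by rewrite -modnMmr -modnXm hu modnXm modnMmr exp1n muln1.
by move=> rn; move/negP: nrep; apply; apply: rep3_complete => //; apply: repC13.
Qed.

Lemma modulusP a b c : large_test a b c ->
  [/\ (8 %| nn (modulus a b c))%N, (nn (modulus a b c) <= 168)%N,
    (0 < nn a)%N && (0 < nn b)%N && (0 < nn c)%N,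
    forall q, prime q -> odd q -> (q %| nn a * nn b * nn c)%N -> (q %| nn (modulus a b c))%N &
    coprime 11 (nn (modulus a b c)) /\ exists2 v, coprime v (nn (modulus a b c)) &
       rep (nn a) (nn b) (nn c) v].
Proof.
have M8 : (8 %| nn (modulus a b c))%N.
  by rewrite /modulus; apply/dvdnP; eexists; rewrite N2Nat.inj_mul mulnC.
rewrite /large_test; move: (modulus a b c) M8 => M M8.
case/and5P=> /N.leb_spec0 M168 Mabc g11 /N.ltb_spec0 abc0; rewrite searchE => /hasP[v vo].
case: ifP => // gv rv; split=> //; first by lia.
- have nz x : x <> 0 -> (0 < nn x)%N by lia.
  by rewrite !nz // => E0; move: abc0; rewrite E0 ?N.mul_0_r ?N.mul_0_l; lia.
- move=> q pq _ qabc.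
  rewrite mod_eq0 in Mabc; last by lia.
  have : (q %| nn (M ^ 10))%N.
    apply: dvdn_trans Mabc.
    by have -> : nn (a * b * c) = (nn a * nn b * nn c)%N by clear; lia.
  have -> : nn (M ^ 10) = (nn M ^ 10)%N by clear; lia.
  by rewrite Euclid_dvdX // => /andP[].
split; first by apply: (@coprime_N 11).
exists (nn v); last exact: rep3_sound.
by apply: coprime_N => //; have [/= o _] := mem_odd_numbers vo; lia.
Qed.

Lemma oreg_perm a b c : oreg a b c -> oreg a c b.
Proof. by move/oregC12/oregC13/oregC12. Qed.

Section Closure.
Variables (a b c : N) (p : nat).
Hypotheses (a0 : 0 < a) (b0 : 0 < b) (c0 : 0 < c) (pp : prime p) (op : odd p).
Hypothesis (pa : ~~ (p %| nn a)%N).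
Let P := N.of_nat p.
Let P0 : P <> 0. Proof. by move=> E; have := prime_gt0 pp; lia. Qed.
Let nP : nn P = p. Proof. exact: Nat2N.id. Qed.

Lemma up_sqr_in_table : b <= c -> sort3 a b c \in table ->
  oreg (nn a) (p ^ 2 * nn b) (p ^ 2 * nn c) ->
  sort3 a (P * P * b) (P * P * c) \in table.
Proof.
move=> bc gt reg; have /allP small := table_up_closed; have /allP large := table_large_tests.
have [M8 M168 _ hM [c11 [v cv rv]]] := modulusP (sort3_roles bc gt large).
have [ple|plt] := leqP p 168; last first.
  by case: (oreg_up_sqr_large M8 hM _ _ _ rv cv c11 pp _ _ reg); lia.
have [sq psq hsq] := mem_small_primes pp op ple.
have := sort3_roles bc gt (allP (small _ psq)).
rewrite /up_test mod_eq0 // nP (negPf pa); case: ifP => [/knownP //|_].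
move/witness_testP => /(_ hsq); rewrite nP => h.
have [|||||m [x [om pm ax nrep rm]]] := h; [by []|by []|by lia..|].
case: nrep; have E d : nn (P * P * d) = (p ^ 2 * nn d)%N by rewrite -nP; lia.
rewrite !E; apply: (witness_up_sqr pp op om pm ax _ reg) => q _ _.
exact/rep_loc/rep3_sound.
Qed.

(** Here [p] divides a coefficient of a form in the table, hence is small. *)
Lemma up_in_table : b <= c -> sort3 (P * a) b c \in table ->
  oreg (nn a) (p * nn b) (p * nn c) -> sort3 a (P * b) (P * c) \in table.
Proof.
move=> bc gt reg; have /allP small := table_up_closed; have /allP large := table_large_tests.
have [_ M168 _ hM [c11 _]] := modulusP (sort3_roles bc gt large).
have E d : nn (P * d) = (p * nn d)%N by rewrite -nP; lia.
have ple : (p <= 168)%N.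
  apply: leq_trans M168; apply: dvdn_leq; first by rewrite lt0n; apply: contraTneq c11 => ->.
  by apply: hM => //; rewrite E -!mulnA dvdn_mulr.
have [sq psq hsq] := mem_small_primes pp op ple.
have := sort3_roles bc gt (allP (small _ psq)).
rewrite /up_test mod_eq0 // E nP dvdn_mulr //.
have -> : P * a / P = a by rewrite N.mul_comm N.div_mul.
rewrite mod_eq0 // nP (negPf pa); case: ifP => [/knownP //|_].
move/witness_testP => /(_ hsq); rewrite nP => h.
have [|||||m [x [om pm ax nrep rm]]] := h; [by []|by []|by lia..|].
case: nrep; rewrite !E; apply: (witness_up pp op om pm ax _ reg).
by rewrite -!E; apply: rep3_sound.
Qed.
End Closure.

End Computation.

(** * Every odd-regular form is in the table *)

Lemma odd_N m : odd (N.to_nat m) -> N.odd m.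
Proof. by move=> om; apply/N.odd_spec; exists (N.of_nat (N.to_nat m)./2); lia. Qed.

Definition primitive a b c := forall q, prime q -> q %| a -> q %| b -> q %| c -> False.

Definition tabulated a b c : Prop :=
  sort3 (N.of_nat a) (N.of_nat b) (N.of_nat c) \in table.

Lemma tabulatedC12 a b c : tabulated a b c -> tabulated b a c.
Proof. by rewrite /tabulated sort3C12. Qed.

Lemma tabulatedC23 a b c : tabulated a b c -> tabulated a c b.
Proof. by rewrite /tabulated sort3C23. Qed.

Lemma terminal_sorted_tabulated a b c : 0 < a -> a <= b -> b <= c ->
  primitive a b c -> terminal a b c -> oreg a b c -> tabulated a b c.
Proof.
move=> a0 ab bc pr tm h.
rewrite /tabulated /sort3; case: N.leb_spec; last by lia.
case: N.leb_spec; last by lia.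
move=> _ _.
have [r hr] : exists r, r \in odd_classes (N.of_nat a) (N.of_nat b) (N.of_nat c).
  have : has odd [:: a; b; c].
    apply: contraT; rewrite /= orbF !negb_or -!dvdn2 => /and3P[a2 b2 c2].
    by case: (pr 2).
  rewrite /= orbF => od.
  have mem x y z s : (x \in [:: 0; 1; 4] -> y \in [:: 0; 1; 4] -> z \in [:: 0; 1; 4] ->
     s = N.of_nat a * x + N.of_nat b * y + N.of_nat c * z -> odd (N.to_nat s) ->
     N.land s 7 \in odd_classes (N.of_nat a) (N.of_nat b) (N.of_nat c))%num.
    move=> hx hy hz Es os; rewrite mem_filter; apply/andP; split.
      by apply: odd_N; rewrite land7 to_nat_mod //; move: os; clear; lia.
    apply/allpairsP; exists (N.of_nat a * x + N.of_nat b * y, z)%num.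
    split; [|exact: hz|by rewrite Es].
    by apply/allpairsP; exists (x, y).
  case/or3P: od => o; eexists; [apply: (@mem 1 0 0)%num|apply: (@mem 0 1 0)%num|
    apply: (@mem 0 0 1)%num]; by [|reflexivity|move: o; lia].
apply: (terminal_in_table _ _ _ _ _ hr); rewrite ?Nat2N.id //; lia.
Qed.

Lemma terminal_tabulated a b c : 0 < a -> 0 < b -> 0 < c ->
  primitive a b c -> terminal a b c -> oreg a b c -> tabulated a b c.
Proof.
move=> a0 b0 c0 pr tm h.
wlog bc : b c b0 c0 pr tm h / b <= c.
  move=> W; case: (leqP b c) => [|/ltnW] bc; first exact: W.
  apply: tabulatedC23; apply: W => //; last exact: oreg_perm.
    by move=> q pq qa qc qb; apply: (pr q).
  by case: tm => ab ac bc'; split=> //; apply: odd_coprimeC.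
have [ab ac bc'] := tm.
have [le|/ltnW ba] := leqP a b; first exact: terminal_sorted_tabulated.
apply: tabulatedC12; have [le|/ltnW ca] := leqP a c.
  apply: terminal_sorted_tabulated => //; last exact: oregC12.
    by move=> q pq qa qb; apply: (pr q).
  by split=> //; apply: odd_coprimeC.
apply: tabulatedC23; apply: terminal_sorted_tabulated => //; last first.
- by apply/oreg_perm/oregC12.
- by split=> //; apply: odd_coprimeC.
by move=> q pq qb qc qa; apply: (pr q).
Qed.

(** One step down: the smaller form is in the table by induction, and the closure of
    the table brings the form itself into it. *)
Lemma descend a b c p : 0 < a -> 0 < b -> 0 < c -> b <= c ->
  primitive a b c -> oreg a b c ->
  prime p -> odd p -> p %| b -> p %| c ->
  (forall a' b' c', 0 < a' -> 0 < b' -> 0 < c' -> primitive a' b' c' ->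
     oreg a' b' c' -> a' * b' * c' < a * b * c -> tabulated a' b' c') ->
  tabulated a b c.
Proof.
move=> a0 b0 c0 bc pr h pp op /dvdnP[b1 Eb] /dvdnP[c1 Ec] IH.
have p0 := prime_gt0 pp; have p1 := prime_gt1 pp.
have pa : ~~ (p %| a) by apply/negP => pa; apply: (pr p); rewrite ?Eb ?Ec ?dvdn_mull.
have b10 : 0 < b1 by move: b0; rewrite Eb muln_gt0 => /andP[].
have c10 : 0 < c1 by move: c0; rewrite Ec muln_gt0 => /andP[].
have bc1 : b1 <= c1 by move: bc; rewrite Eb Ec leq_pmul2r.
have ofM x y : N.of_nat (x * y) = (N.of_nat x * N.of_nat y)%num by lia.
have paN : ~~ (p %| N.to_nat (N.of_nat a)) by rewrite Nat2N.id.
have [/andP[/dvdnP[b2 Eb2] /dvdnP[c2 Ec2]]|npp] := boolP ((p %| b1) && (p %| c1)).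
  have {Eb Eb2} Eb : b = p ^ 2 * b2 by rewrite Eb Eb2; lia.
  have {Ec Ec2} Ec : c = p ^ 2 * c2 by rewrite Ec Ec2; lia.
  have b20 : 0 < b2 by move: b0; rewrite Eb muln_gt0 => /andP[].
  have c20 : 0 < c2 by move: c0; rewrite Ec muln_gt0 => /andP[].
  have bc2 : b2 <= c2 by move: bc; rewrite Eb Ec leq_pmul2l // expn_gt0 p0.
  have g : tabulated a b2 c2.
    apply: IH => //.
    - by move=> q pq qa qb qc; apply: (pr q); rewrite ?Eb ?Ec ?dvdn_mull.
    - by apply: (oreg_down_sqr pp pa) => //; rewrite -Eb -Ec.
    rewrite -!mulnA ltn_pmul2l // Eb Ec.
    apply: (@leq_ltn_trans (p ^ 2 * b2 * c2)); last first.
      by rewrite ltn_pmul2l ?muln_gt0 ?expn_gt0 ?p0 // ltn_Pmull // (@ltn_exp2l p 0 2).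
    by rewrite leq_mul2r leq_pmull ?orbT // expn_gt0 p0.
  have ofM2 x : N.of_nat (p ^ 2 * x) = (N.of_nat p * N.of_nat p * N.of_nat x)%num.
    by rewrite -mulnn; lia.
  rewrite /tabulated Eb Ec !ofM2.
  apply: up_sqr_in_table => //; try lia; rewrite ?Nat2N.id -?Eb -?Ec //.
rewrite mulnC in Eb; rewrite mulnC in Ec.
have g : tabulated (p * a) b1 c1.
  apply: IH => //; first by rewrite muln_gt0 p0.
  - move=> q pq; rewrite Euclid_dvdM // dvdn_prime2 // => /orP[/eqP ->|qa] qb qc.
      by move: npp; rewrite qb qc.
    by apply: (pr q); rewrite ?Eb ?Ec ?dvdn_mull.
  - by apply: (oreg_down pp pa) => //; rewrite -Eb -Ec.
  rewrite Eb Ec (_ : p * a * b1 * c1 = p * (a * b1 * c1)); last by ring.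
  rewrite (_ : a * (p * b1) * (p * c1) = p * (p * (a * b1 * c1))); last by ring.
  by rewrite ltn_pmul2l // ltn_Pmull // !muln_gt0 a0 b10.
rewrite /tabulated Eb Ec !ofM; apply: up_in_table => //; try lia.
  by rewrite -ofM.
by rewrite !Nat2N.id -Eb -Ec.
Qed.

Lemma oreg_tabulated a b c : 0 < a -> 0 < b -> 0 < c -> primitive a b c ->
  oreg a b c -> tabulated a b c.
Proof.
have [n] := ubnP (a * b * c); elim: n a b c => // n IHn a b c le a0 b0 c0 pr h.
have IH a' b' c' : 0 < a' -> 0 < b' -> 0 < c' -> primitive a' b' c' ->
     oreg a' b' c' -> a' * b' * c' < a * b * c -> tabulated a' b' c'.
  by move=> ? ? ? ? ? lt; apply: IHn => //; apply: leq_trans lt _.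
have common x y z p : 0 < x -> 0 < y -> 0 < z -> primitive x y z -> oreg x y z ->
    x * y * z = a * b * c -> prime p -> odd p -> p %| y -> p %| z -> tabulated x y z.
  move=> x0 y0 z0 prx hx E pp op py pz.
  case: (leqP y z) => [|/ltnW] yz.
    by apply: (@descend _ _ _ p) => // *; apply: IH; rewrite -?E.
  apply: tabulatedC23; apply: (@descend _ _ _ p) => //.
  - by move=> q pq qx qz qy; apply: (prx q).
  - exact: oreg_perm.
  by move=> *; apply: IH => //; rewrite -E (mulnAC x).
have [/asboolP[p [pp op pa pb]]|nab] := boolP `[< exists p, [/\ prime p, odd p, p %| a & p %| b] >].
  apply/tabulatedC23/tabulatedC12/(@common _ _ _ p) => //.
  - by move=> q pq qc qa qb; apply: (pr q).
  - by apply/oregC12/oreg_perm.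
  by lia.
have [/asboolP[p [pp op pa pc]]|nac] := boolP `[< exists p, [/\ prime p, odd p, p %| a & p %| c] >].
  apply/tabulatedC12/(@common _ _ _ p) => //.
  - by move=> q pq qb qa qc; apply: (pr q).
  - exact: oregC12.
  by lia.
have [/asboolP[p [pp op pb pc]]|nbc] := boolP `[< exists p, [/\ prime p, odd p, p %| b & p %| c] >].
  exact: (@common _ _ _ p).
apply: terminal_tabulated => //; split=> q pq oq q1 q2.
- by case/negP: nab; apply/asboolP; exists q.
- by case/negP: nac; apply/asboolP; exists q.
by case/negP: nbc; apply/asboolP; exists q.
Qed.

Local Open Scope classical_set_scope.
Local Open Scope card_scope.

Theorem theorem5p3 :
  [set t : nat * nat * nat | let: (a, b, c) := t in
     [/\ (0 < a)%N, (a <= b)%N, (b <= c)%N, gcdn (gcdn a b) c = 1%N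
       & odd_regular (diag_form a b c)]] #<= `I_147.
Proof.
pose f (t : N * N * N) := (N.to_nat t.1.1, N.to_nat t.1.2, N.to_nat t.2).
pose l := [seq f t | t <- table].
apply: card_le_trans (card_image_le (nth (0, 0, 0)%N l) `I_147).
apply: subset_card_le => -[[a b] c] /= [a0 ab bc g reg].
suff /nthP -/(_ (0, 0, 0)%N)[i il E] : (a, b, c) \in l by exists i; first exact: il.
have b0 := leq_trans a0 ab; have c0 := leq_trans b0 bc.
have h : tabulated a b c.
  apply: oreg_tabulated => //; last exact: odd_regular_oreg.
  move=> q pq qa qb qc; have : q %| gcdn (gcdn a b) c by rewrite !dvdn_gcd qa qb.
  by rewrite g dvdn1 => /eqP q1; rewrite q1 in pq.
apply/mapP; exists (N.of_nat a, N.of_nat b, N.of_nat c); last by rewrite /f /= !Nat2N.id.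
move: h; rewrite /tabulated /sort3; case: N.leb_spec; last by lia.
by case: N.leb_spec => //; lia.
Qed.
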